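(* Let $(\mathcal M,\langle\cdot,\cdot\rangle,J)$ be one of the $2n$-dimensional pseudo-Riemannian complex space forms $\mathbb{CP}^n_{p,c}$ or para-complex space forms $\mathbb{DP}^n$, $\overline{\mathbb{DP}^n}$ (with holomorphic or para-holomorphic curvature $4c$, $c=\pm1$). Let $\mathcal S$ be a connected, non-degenerate real hypersurface of $\mathcal M$ with unit normal vector field $N$, shape operator $A$ and structure vector field $\xi$. Assume that $\mathcal S$ is Hopf, i.e. $\xi$ is a principal direction of $\mathcal S$. Then the corresponding principal curvature $a$, i.e. the function $a$ on $\mathcal S$ defined by $A\xi=a\xi$, is constant.
   Context: Ambient spaces. Let $c\in\{1,-1\}$ and $\varepsilon\in\{1,-1\}$; $\varepsilon=1$ is the complex case and $\varepsilon=-1$ the para-complex case. Complex case ($\varepsilon=1$): on $\mathbb C^{n+1}$ take the metric $\langle\cdot,\cdot\rangle_{2p}=\mathrm{Re}\big(-\sum_{j=1}^p dz_j\,d\bar z_j+\sum_{j=p+1}^{n+1}dz_j\,d\bar z_j\big)$. The space $\mathbb{CP}^n_{p,c}$ is the quotient of the (non-empty) hyperquadric $\{z\in\mathbb C^{n+1}:\langle z,z\rangle_{2p}=c\}$ by the action of unit complex numbers, with the metric making the projection a pseudo-Riemannian submersion and the complex structure $J$ induced by multiplication by $i$. Para-complex case ($\varepsilon=-1$): the para-complex numbers $\mathbb D$ are $\mathbb R^2$ with product $(x,y)(x',y')=(xx'+yy',xy'+x'y)$. On $\mathbb D^{n+1}$ take the metric $\langle\cdot,\cdot\rangle_*=\sum_{j=1}^{n+1}(dx_j^2-dy_j^2)$.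 For $c=1$, $\mathbb{DP}^n$ is the quotient of $\{z\in\mathbb D^{n+1}:\langle z,z\rangle_*=-1\}$ by the action $z\mapsto(\cosh\theta,\sinh\theta)\,z$, $\theta\in\mathbb R$; for $c=-1$, $\overline{\mathbb{DP}^n}$ is the quotient of $\{z:\langle z,z\rangle_*=1\}$ by the same action. Both carry the metric making the projection a pseudo-Riemannian submersion and the para-complex structure $J$ induced by multiplication by $(0,1)$. In all cases $J^2=-\varepsilon\,\mathrm{Id}$, $\langle J\cdot,J\cdot\rangle=\varepsilon\langle\cdot,\cdot\rangle$, $J$ is parallel, and the curvature is $R(X,Y)=c\,(\varepsilon X\wedge Y+JX\wedge JY+2\langle X,JY\rangle J)$, where $(X\wedge Y)Z=\langle Y,Z\rangle X-\langle X,Z\rangle Y$. Hypersurfaces. A real hypersurface $\mathcal S$ is an immersed submanifold of real codimension 1; it is non-degenerate if its induced metric is non-degenerate. The unit normal field $N$ satisfies $\langle N,N\rangle=\pm1$, and the shape operator $A$ is defined by $\nabla_XN=-AX$ for $X$ tangent to $\mathcal S$, where $\nabla$ is the Levi-Civita connection of $\mathcal M$. The structure vector field is the tangent field $\xi:=-\varepsilon JN$. A principal direction is an eigenvector of $A$.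
   Formalization: The formal theorem assumes n ≥ 2: for n = 1 the claim fails, since every curve in the surface M (e.g. a curve of non-constant geodesic curvature in CP^1) is Hopf and a is its geodesic curvature up to sign. *)

(* Defs.v *)
From HB Require Import structures.
From mathcomp Require Import all_boot all_order all_algebra.
From mathcomp Require Import all_classical all_reals all_analysis.

Set Implicit Arguments.
Unset Strict Implicit.
Unset Printing Implicit Defensive.

Import Order.TTheory GRing.Theory Num.Theory.
Import numFieldNormedType.Exports.

Local Open Scope classical_set_scope.
Local Open Scope ring_scope.

Section Smoothness.
Context {R : realType} {V W : normedModType R}.

Fixpoint Ck_on (k : nat) (U : set V) (f : V -> W) : Prop :=
  match k with
  | 0%N => forall x, U x -> {for x, continuous f}
  | k'.+1 => (forall x, U x -> differentiable f x) /\
             (forall v, Ck_on k' U (fun x => 'D_v f x))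
  end.

(* Meant for open [U]; the values of [f] outside [U] are irrelevant. *)
Definition smooth_on (U : set V) (f : V -> W) : Prop :=
  forall k, Ck_on k U f.

End Smoothness.

Section Manifolds.
Context {R : realType} {S : topologicalType} {m : nat}.

Record chart := Chart {
  cdom : set S;
  cmap : S -> 'rV[R]_m;
  cinv : 'rV[R]_m -> S }.

Definition is_chart (c : chart) : Prop :=
  [/\ open (cdom c), open (cmap c @` cdom c),
      forall x, cdom c x -> cinv c (cmap c x) = x,
      {within cdom c, continuous (cmap c)} &
      {within cmap c @` cdom c, continuous (cinv c)}].

Definition smooth_atlas (A : set chart) : Prop :=
  [/\ forall c, A c -> is_chart c,
      forall x : S, exists2 c, A c & cdom c x &
      forall c c', A c -> A c' ->
        smooth_on (cmap c @` (cdom c `&` cdom c')) (cmap c' \o cinv c)].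

End Manifolds.
Arguments chart : clear implicits.

(* A pseudo-Riemannian metric on an open subset of R^d is given by its matrix
   of coefficients [g p]. *)
Section LeviCivita.
Context {R : realType} {d : nat}.
Implicit Types (g : 'rV[R]_d -> 'M[R]_d) (p v w : 'rV[R]_d).

Definition christoffel g p (k i j : 'I_d) : R :=
  2^-1 * \sum_(l < d) invmx (g p) k l *
    ('D_(delta_mx 0 i) (fun q => g q j l) p
     + 'D_(delta_mx 0 j) (fun q => g q i l) p
     - 'D_(delta_mx 0 l) (fun q => g q i j) p).

Definition christoffel_form g p v w : 'rV[R]_d :=
  \row_k \sum_(i < d) \sum_(j < d) christoffel g p k i j * v 0 i * w 0 j.

(* Levi-Civita covariant derivative at [u], in the direction [X], of the vector
   field [Z] along the map [y]. *)
Definition covD {m : nat} g (y Z : 'rV[R]_m -> 'rV[R]_d) (u X : 'rV[R]_m) :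
    'rV[R]_d :=
  'D_X Z u + christoffel_form g (y u) ('D_X y u) (Z u).

End LeviCivita.

(* [CP p b] is CP^n_{p,c} with c = (-1)^b, i.e. c = 1 for [b = false] and
   c = -1 for [b = true]; [DP] is DP^n (c = 1) and [DPbar] is its conjugate
   (c = -1). *)
Variant space_form := CP of nat & bool | DP | DPbar.

Section SpaceForm.
Context {R : realType} {n : nat}.
Variable s : space_form.

(* z = (x, y) stands for x + i y in C^{n+1}, or for (x, y) in D^{n+1}. *)
Let E : Type := ('rV[R]_n.+1 * 'rV[R]_n.+1)%type.
Implicit Types z v w : E.

Definition eps : R := if s is CP _ _ then 1 else -1.

Definition ambient_form z w : R :=
  match s with
  | CP p _ => \sum_(j < n.+1)
      (-1) ^+ (j < p)%N * (z.1 0 j * w.1 0 j + z.2 0 j * w.2 0 j)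
  | _ => \sum_(j < n.+1) (z.1 0 j * w.1 0 j - z.2 0 j * w.2 0 j)
  end.

Definition quadric_level : R :=
  match s with CP _ b => (-1) ^+ b | DP => -1 | DPbar => 1 end.

Definition quadric : set E := [set z | ambient_form z z = quadric_level].

Definition admissible : Prop :=
  quadric !=set0 /\ (if s is CP p _ then (p <= n.+1)%N else true).

(* Multiplication by the complex or para-complex number a = (a.1, a.2). *)
Definition scal (a : R * R) z : E :=
  (a.1 *: z.1 - (eps * a.2) *: z.2, a.1 *: z.2 + a.2 *: z.1).

Definition Jmul z : E := scal (0, 1) z.

(* The unit complex numbers, resp. the (cosh t, sinh t). *)
Definition unit_numbers : set (R * R) :=
  if s is CP _ _ then [set a | a.1 ^+ 2 + a.2 ^+ 2 = 1]
  else [set ((expR t + expR (- t)) / 2, (expR t - expR (- t)) / 2)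
         | t in [set: R]].

Definition orbit z : set E := [set scal a z | a in unit_numbers].

Definition space_form_point : Type :=
  {o : set E | exists2 z, quadric z & o = orbit z}.

(* The vertical line at z is spanned by [Jmul z]. *)
Definition horizontal z v : Prop :=
  ambient_form v z = 0 /\ ambient_form v (Jmul z) = 0.

Definition hproj z v : E :=
  v - (ambient_form v z / ambient_form z z) *: z
    - (ambient_form v (Jmul z) / ambient_form (Jmul z) (Jmul z)) *: Jmul z.

(* The tangent space of the quotient at [orbit z] is the horizontal space at z,
   a horizontal vector v at z being identified with [scal a v] at [scal a z];
   this makes the projection a pseudo-Riemannian submersion. *)
Definition torbit z v : set (E * E) :=
  [set (scal a z, scal a v) | a in unit_numbers].

Definition space_form_tangent : Type :=
  {o : set (E * E) |
    exists z v, [/\ quadric z, horizontal z v & o = torbit z v]}.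

Section Parametrization.
Variable sigma : 'rV[R]_(n.*2) -> E.

(* Differential at p of [orbit \o sigma], with values in the horizontal space at
   [sigma p]. *)
Definition dproj (p v : 'rV[R]_(n.*2)) : E := hproj (sigma p) ('D_v sigma p).

(* Charts of the quotient are the inverses of the maps [orbit \o sigma]. *)
Definition is_param (V : set 'rV[R]_(n.*2)) : Prop :=
  [/\ open V, smooth_on V sigma,
      forall p, V p -> quadric (sigma p),
      forall p q, V p -> V q -> orbit (sigma p) = orbit (sigma q) -> p = q &
      forall p (w : 'rV_(n.*2)), V p -> dproj p w = 0 -> w = 0].

Definition metric (p v w : 'rV[R]_(n.*2)) : R :=
  ambient_form (dproj p v) (dproj p w).

Definition metric_mx (p : 'rV[R]_(n.*2)) : 'M[R]_(n.*2) :=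
  \matrix_(i, j) metric p (delta_mx 0 i) (delta_mx 0 j).

End Parametrization.

Section Hypersurface.
Variable S : topologicalType.
Let m := (n.*2).-1.

(* Coordinates in which a map from S to the space form reads [pos] and a vector
   field along it reads [nor]. *)
Record coords := Coords {
  src : chart R S m;
  par : 'rV[R]_(n.*2) -> E;
  pdom : set 'rV[R]_(n.*2);
  udom : set 'rV[R]_m;
  pos : 'rV[R]_m -> 'rV[R]_(n.*2);
  nor : 'rV[R]_m -> 'rV[R]_(n.*2) }.

Definition adapted (A : set (chart R S m)) (f : S -> space_form_point)
    (N : S -> space_form_tangent) (k : coords) : Prop :=
  [/\ A (src k) /\ is_param (par k) (pdom k),
      open (udom k) /\ udom k `<=` cmap (src k) @` cdom (src k),
      smooth_on (udom k) (pos k) /\ pos k @` udom k `<=` pdom k,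
      smooth_on (udom k) (nor k) &
      forall u, udom k u ->
        sval (f (cinv (src k) u)) = orbit (par k (pos k u)) /\
        sval (N (cinv (src k) u)) =
          torbit (par k (pos k u)) (dproj (par k) (pos k u) (nor k u))].

Definition coords_at (k : coords) (x : S) : Prop :=
  cdom (src k) x /\ udom k (cmap (src k) x).

Definition dpos (k : coords) (u X : 'rV[R]_m) : 'rV[R]_(n.*2) :=
  'D_X (pos k) u.

Definition kmetric (k : coords) (u : 'rV[R]_m) (v w : 'rV[R]_(n.*2)) : R :=
  metric (par k) (pos k u) v w.

(* Non-degenerate immersed real hypersurface with a smooth unit normal field. *)
Record hypersurface := Hypersurface {
  atlas : set (chart R S m);
  imm : S -> space_form_point;
  normal : S -> space_form_tangent;
  hs_coords := adapted atlas imm normal;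
  hs_hausdorff : hausdorff_space S;
  hs_second_countable : @second_countable S;
  hs_atlas : smooth_atlas atlas;
  hs_smooth : forall x, exists2 k, hs_coords k & coords_at k x;
  hs_immersion : forall k u X, hs_coords k -> udom k u ->
    dpos k u X = 0 -> X = 0;
  hs_nondegenerate : forall k u X, hs_coords k -> udom k u ->
    (forall Y, kmetric k u (dpos k u X) (dpos k u Y) = 0) -> X = 0;
  hs_normal : forall k u X, hs_coords k -> udom k u ->
    kmetric k u (dpos k u X) (nor k u) = 0;
  hs_unit : forall k u, hs_coords k -> udom k u ->
    kmetric k u (nor k u) (nor k u) = 1 \/
    kmetric k u (nor k u) (nor k u) = -1 }.

(* X is the coordinate expression of xi = - eps J N. *)
Definition is_structure_vector (k : coords) (u X : 'rV[R]_m) : Prop :=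
  dproj (par k) (pos k u) (dpos k u X) =
  - eps *: Jmul (dproj (par k) (pos k u) (nor k u)).

(* A X = Y, for the shape operator A given by nabla_X N = - A X. *)
Definition is_shape (k : coords) (u X Y : 'rV[R]_m) : Prop :=
  covD (metric_mx (par k)) (pos k) (nor k) u X = - dpos k u Y.

(* A xi = lambda xi at x. The relation is tensorial, hence independent of the
   coordinates around x, which exist by [hs_smooth]. *)
Definition xi_curvature (h : hypersurface) (x : S) (lambda : R) : Prop :=
  forall k, hs_coords h k -> coords_at k x ->
  let u := cmap (src k) x in
  exists2 X, is_structure_vector k u X & is_shape k u X (lambda *: X).

Definition Hopf (h : hypersurface) : Prop :=
  forall x, exists lambda, xi_curvature h x lambda.

End Hypersurface.
End SpaceForm.

Arguments admissible : clear implicits.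
Arguments hypersurface : clear implicits.

(* Main.v *)
Require Import Defs.
From HB Require Import structures.
From mathcomp Require Import all_boot all_order all_algebra.
From mathcomp Require Import ring lra.
From mathcomp Require Import all_classical all_reals all_analysis.

Set Implicit Arguments.
Unset Strict Implicit.
Unset Printing Implicit Defensive.

Import Order.TTheory GRing.Theory Num.Theory.
Import numFieldNormedType.Exports.

Local Open Scope classical_set_scope.
Local Open Scope ring_scope.

(** The hypersurface is lifted to the quadric. Locally it becomes a map z with
    <z, z> = q = +-1, together with the horizontal lift N of the unit normal,
    <N, N> = d = +-1; write e for [eps], so that J ^ 2 = - e. Let H be the orthogonal
    complement of z, J z, N, J N. For a coordinate direction X,

      D_X z = alp X + tau X J z - e eta X J N,
      D_X N = bet X + sig X J N - d e q eta X J z,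

    with alp X and bet X in H. Here eta (xi) = 1, and bet is minus alp composed with
    the shape operator. The symmetry of second derivatives gives the structure
    equations ([d_tau], [d_eta], [d_sig], [shape_symmetric])

      dtau (X, Y) = - 2 e q <alp X, J alp Y>,
      deta (X, Y) = d (<alp X, J bet Y> - <alp Y, J bet X>),
      dsig (X, Y) = - 2 e d <bet X, J bet Y>.

    The Hopf condition says that alp and bet vanish on xi and, by symmetry of the
    shape operator, that sig - tau = e a eta, where a is the principal curvature.
    Inserting xi into the structure equations yields da = (xi a) eta, and a further
    derivative yields (xi a) deta = 0.

    Suppose that da does not vanish at some point. Near it eta is closed and
    dsig = dtau, so that the operator S of H with S (alp X) = bet X is symmetric,
    anticommutes with J and has square - q d ([be_alJ], [be_be]). For a suitable
    connection on H, the Codazzi equation makes the covariant derivative of S a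
    totally symmetric cubic form. Since S ^ 2 is constant this form changes sign
    when S moves from one argument to another, so it vanishes ([cubic0]). A parallel S
    commutes with the curvature of H, which is explicit, and evaluating this on
    x and J x gives <x, x> = 0 for all x in H ([null_al]). As H is nondegenerate, H = 0,
    which is impossible for n >= 2 ([no_flat_Hopf]). Thus a is locally constant, and
    it is constant by connectedness. No step needs the shape operator to be
    diagonalizable, so the indefinite metrics make no difference.

    The shape operator is given through Christoffel symbols of the quotient metric.
    The link with the equations above is that a horizontal lift of the Levi-Civita
    derivative of the quotient is the horizontal part of the ambient derivative,
    corrected by - tau J ([dproj_christoffel_form], [dproj_covD]). *)

(** * Calculus of smooth maps *)

Section Calculus.
Context {R : realType}.

Lemma open_near (V : normedModType R) (U : set V) x :
  open U -> U x -> \forall y \near x, U y.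
Proof. by move=> oU Ux; apply: open_nbhs_nbhs; split. Qed.

(** [differentiable] is stated with the chosen differential ['d f x], so a
    function that agrees with f only near x is handled through the expansion
    of f and the uniqueness of differentials. *)
Lemma near_eq_differentiable (V W : normedModType R) (f g : V -> W) x :
  (\near x, f x = g x) -> differentiable f x -> differentiable g x.
Proof.
move=> fg df.
have E : g \o shift x = cst (g x) + 'd f x +o_ 0 id.
  apply/eqaddoP => e e0.
  have /eqaddoP/(_ e e0) fe := diff_locally df.
  have fg0 : \forall h \near (0 : V), f (h + x) = g (h + x).
    by move: fg; rewrite (near_shift 0 x) subr0.
  apply: filterS2 fg0 fe => h fgh.
  by rewrite !fctE /= -fgh -(nbhs_singleton fg).
apply/diff_locallyP.
have -> : ('d g x : V -> W) = 'd f x.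
  by apply: diff_unique => //; exact: diff_continuous.
by split=> //; exact: diff_continuous.
Qed.

Lemma Ck_on_eq (V W : normedModType R) k (U : set V) (f g : V -> W) :
  open U -> (forall x, U x -> f x = g x) -> Ck_on k U f -> Ck_on k U g.
Proof.
move=> oU; elim: k f g => [|k IH] f g fg /=.
  move=> cf x Ux; have /= cfx := cf x Ux.
  suff : g y @[y --> x] --> g x by [].
  rewrite -(fg x Ux); apply: cvg_trans cfx; apply: near_eq_cvg.
  by apply: filterS (open_near oU Ux) => y Uy; apply: fg.
move=> [df kf]; split.
  move=> x Ux; apply: near_eq_differentiable (df x Ux).
  by apply: filterS (open_near oU Ux) => y Uy; apply: fg.
move=> v; apply: IH (kf v) => x Ux; apply: near_eq_derive.
by apply: filterS (open_near oU Ux) => y Uy; apply: fg.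
Qed.

Lemma Ck_onS (V W : normedModType R) k (U : set V) (f : V -> W) :
  Ck_on k.+1 U f -> Ck_on k U f.
Proof.
elim: k f => [|k IH] f [df kf].
  by move=> x Ux; apply: differentiable_continuous; apply: df.
by split=> // v; apply: IH.
Qed.

Lemma Ck_on_sub (V W : normedModType R) k (U U' : set V) (f : V -> W) :
  U' `<=` U -> Ck_on k U f -> Ck_on k U' f.
Proof.
move=> UU; elim: k f => [|k IH] f; first by move=> cf x /UU; apply: cf.
by move=> [df kf]; split=> [x /UU /df|v] //; exact/IH/kf.
Qed.

Lemma Ck_on_cst (V W : normedModType R) k (U : set V) (c : W) :
  Ck_on k U (fun=> c).
Proof.
elim: k c => [|k IH] c; first by move=> x _ /=; apply: cst_continuous.
split=> [x _|v]; first exact: differentiable_cst.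
suff -> : (fun x => 'D_v (fun=> c) x) = (fun=> 0 : W) by exact: IH.
by apply/funext => x; exact: derive_cst.
Qed.

Lemma Ck_onD (V W : normedModType R) k (U : set V) (f g : V -> W) :
  open U -> Ck_on k U f -> Ck_on k U g -> Ck_on k U (fun x => f x + g x).
Proof.
move=> oU; elim: k f g => [|k IH] f g /=.
  by move=> cf cg x Ux; apply: cvgD; [apply: cf|apply: cg].
move=> [df kf] [dg kg]; split=> [x Ux|v].
  by apply: differentiableD; [apply: df|apply: dg].
apply: (@Ck_on_eq _ _ _ _ (fun x => 'D_v f x + 'D_v g x)) => //; last exact: IH.
move=> x Ux; rewrite -deriveD //; apply: diff_derivable; [exact: df|exact: dg].
Qed.

Section Bilinear.
Context {V U1 U2 W : normedModType R} (B : {bilinear U1 -> U2 -> W}).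
Hypothesis cB : continuous (fun p => B p.1 p.2).

Lemma differentiable_bil (f : V -> U1) (g : V -> U2) x :
  differentiable f x -> differentiable g x ->
  differentiable (fun x => B (f x) (g x)) x.
Proof.
move=> df dg.
apply: (@differentiable_comp _ _ _ _ (fun x => (f x, g x))
  (fun p => B p.1 p.2)); first exact: differentiable_pair.
exact: differentiable_bilin.
Qed.

Lemma derive_bil (f : V -> U1) (g : V -> U2) x v :
  differentiable f x -> differentiable g x ->
  'D_v (fun x => B (f x) (g x)) x = B ('D_v f x) (g x) + B (f x) ('D_v g x).
Proof.
move=> df dg.
rewrite !deriveE //; last exact: differentiable_bil.
pose h x := (f x, g x).
have dh : differentiable h x by exact: differentiable_pair.
have dB : differentiable (fun p => B p.1 p.2) (h x).
  exact: differentiable_bilin.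
have -> : (fun x => B (f x) (g x)) = (fun p => B p.1 p.2) \o h by [].
rewrite (diff_comp dh dB) /= (diff_bilin _ cB) /h /= diff_pair //=.
by rewrite addrC.
Qed.

Lemma Ck_on_bil k (U : set V) (f : V -> U1) (g : V -> U2) :
  open U -> Ck_on k U f -> Ck_on k U g -> Ck_on k U (fun x => B (f x) (g x)).
Proof.
move=> oU; elim: k f g => [|k IH] f g.
  move=> cf cg x Ux.
  apply: (@continuous_comp _ _ _ (fun x => (f x, g x)) (fun p => B p.1 p.2)).
    by apply: cvg_pair; [apply: cf|apply: cg].
  exact: cB.
move=> kf kg; have [df Df] := kf; have [dg Dg] := kg; split=> [x Ux|v].
  by apply: differentiable_bil; [apply: df|apply: dg].
apply: (@Ck_on_eq _ _ _ _
  (fun x => B ('D_v f x) (g x) + B (f x) ('D_v g x))) => //.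
  by move=> x Ux; rewrite derive_bil //; [apply: df|apply: dg].
apply: Ck_onD => //; apply: IH; do ?[exact: Df|exact: Dg].
  exact: Ck_onS kg.
exact: Ck_onS kf.
Qed.
End Bilinear.

End Calculus.

Section CalculusRules.
Context {R : realType}.

Lemma scale_is_bilinear (W : normedModType R) :
  bilinear_for (GRing.Scale.Law.clone _ _ *:%R _)
    (GRing.Scale.Law.clone _ _ *:%R _) (@GRing.scale R W : R -> W -> W).
Proof.
split=> u a x y; first by rewrite scalerDl -scalerA.
by rewrite scalerDr scalerA mulrC -scalerA.
Qed.

HB.instance Definition _ (W : normedModType R) :=
  bilinear_isBilinear.Build R R W W _ _ (@GRing.scale R W)
    (scale_is_bilinear W).

Lemma scale_bil_continuous (W : normedModType R) :
  continuous (fun p : R * W => p.1 *: p.2).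
Proof. exact: scale_continuous. Qed.

Lemma mul_bil_continuous : continuous (fun p : R * R => p.1 * p.2).
Proof. exact: (@scale_bil_continuous R^o). Qed.

Section Linear.
Context {V W W' : normedModType R} (L : W -> W').
Hypotheses (linL : linear L) (cL : continuous L).

Let LL : {linear W -> W'} := HB.pack L (GRing.isLinear.Build _ _ _ _ L linL).

Lemma differentiable_lin (f : V -> W) x :
  differentiable f x -> differentiable (fun x => L (f x)) x.
Proof.
move=> df; apply: (@differentiable_comp _ _ _ _ f LL) => //.
exact: linear_differentiable.
Qed.

Lemma derive_lin (f : V -> W) x v :
  differentiable f x -> 'D_v (fun x => L (f x)) x = L ('D_v f x).
Proof.
move=> df; have dL y : differentiable LL y by exact: linear_differentiable.
rewrite !deriveE //; last exact: differentiable_lin.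
rewrite (_ : (fun x => L (f x)) = LL \o f) // (diff_comp df (dL _)) /=.
by rewrite (diff_lin _ (f := LL)).
Qed.

Lemma Ck_on_lin k (U : set V) (f : V -> W) :
  open U -> Ck_on k U f -> Ck_on k U (fun x => L (f x)).
Proof.
move=> oU; elim: k f => [|k IH] f.
  by move=> cf x Ux; apply: continuous_comp; [exact: cf|exact: cL].
move=> [df Df]; split=> [x Ux|v].
  by apply: differentiable_lin; exact: df.
apply: (@Ck_on_eq _ _ _ _ _ (fun x => L ('D_v f x))) => //.
  by move=> x Ux; rewrite derive_lin //; exact: df.
exact/IH/Df.
Qed.
End Linear.

Lemma coord_linear m n (i : 'I_m) (j : 'I_n) :
  linear (fun M : 'M[R]_(m, n) => M i j : R).
Proof. by move=> a x y; rewrite !mxE. Qed.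

Lemma coord_cont m n (i : 'I_m) (j : 'I_n) :
  continuous (fun M : 'M[R]_(m, n) => M i j : R).
Proof.
by move=> M; apply: differentiable_continuous; exact: differentiable_coord.
Qed.

Lemma Ck_on_sum (V W : normedModType R) k (U : set V) d (f : 'I_d -> V -> W) :
  open U -> (forall i, Ck_on k U (f i)) -> Ck_on k U (fun x => \sum_i f i x).
Proof.
move=> oU; elim: d f => [|d IH] f kf.
  apply: (@Ck_on_eq _ _ _ _ _ (fun=> 0)) => //; last exact: Ck_on_cst.
  by move=> x _; rewrite big_ord0.
apply: (@Ck_on_eq _ _ _ _ _
  (fun x => f ord0 x + \sum_(i < d) f (lift ord0 i) x)) => //.
  by move=> x _; rewrite big_ord_recl.
by apply: Ck_onD => //; exact: IH.
Qed.

Lemma derive_comp (V W : normedModType R) d (f : 'rV[R]_d -> W)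
    (g : V -> 'rV[R]_d) x v :
  differentiable g x -> differentiable f (g x) ->
  'D_v (f \o g) x = 'D_('D_v g x) f (g x).
Proof.
move=> dg df; rewrite deriveE; last exact: differentiable_comp.
by rewrite (diff_comp dg df) /= -!deriveE.
Qed.

Lemma derive_row_sum (W : normedModType R) d (f : 'rV[R]_d -> W) y v :
  differentiable f y ->
  'D_v f y = \sum_j v 0 j *: 'D_(delta_mx 0 j) f y.
Proof.
move=> df; rewrite deriveE // {1}(row_sum_delta v) linear_sum.
by apply: eq_bigr => j _; rewrite linearZ /= deriveE.
Qed.

(** Only the partial derivatives of f are composed with g in the chain rule, so
    the induction hypothesis applies to them; this is why the space in the middle is
    a space of row vectors. *)
Lemma Ck_on_comp (V W : normedModType R) d k (U : set V) (U' : set 'rV[R]_d)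
    (f : 'rV[R]_d -> W) (g : V -> 'rV[R]_d) :
  open U -> g @` U `<=` U' -> Ck_on k U' f -> Ck_on k U g ->
  Ck_on k U (f \o g).
Proof.
move=> oU gU; elim: k f => [|k IH] f.
  move=> cf cg x Ux; apply: continuous_comp; first exact: cg.
  by apply: cf; apply: gU; exists x.
move=> [df Df] kg; have [dg Dg] := kg.
have gU' x : U x -> U' (g x) by move=> Ux; apply: gU; exists x.
split=> [x Ux|v].
  by apply: differentiable_comp; [exact: dg|exact/df/gU'].
apply: (@Ck_on_eq _ _ _ _ _
  (fun x => \sum_j ('D_v g x) 0 j *: 'D_(delta_mx 0 j) f (g x))) => //.
  move=> x Ux; have dgx := dg x Ux; have dfx := df _ (gU' x Ux).
  by rewrite derive_comp // -derive_row_sum.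
apply: Ck_on_sum => // j.
apply: (@Ck_on_bil _ _ _ _ _ (@GRing.scale R W)) => //.
- exact: scale_bil_continuous.
- exact: (Ck_on_lin (@coord_linear _ _ 0 j) (@coord_cont _ _ 0 j) oU (Dg v)).
- by apply: IH (Df _) _; exact: Ck_onS kg.
Qed.

Lemma Ck_on_inv (V : normedModType R) k (U : set V) (f : V -> R) :
  open U -> (forall x, U x -> f x != 0) -> Ck_on k U f ->
  Ck_on k U (fun x => (f x)^-1).
Proof.
move=> oU f0; elim: k => [|k IH].
  by move=> cf x Ux; exact: (cvgV (f0 x Ux) (cf x Ux)).
move=> kf; have [df Df] := kf; split=> [x Ux|v].
  by apply: differentiableV; [exact: df|exact: f0].
apply: (@Ck_on_eq _ _ _ _ _
  (fun x => (f x)^-1 * (f x)^-1 * (- 1 * 'D_v f x))) => //.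
  move=> x Ux; rewrite deriveV; [|exact: f0|exact/diff_derivable/df].
  by rewrite scaleNr mulN1r mulrN -exprVn expr2.
have mulCk (g h : V -> R) : Ck_on k U g -> Ck_on k U h ->
    Ck_on k U (fun x => g x * h x).
  by apply: (@Ck_on_bil _ _ _ _ _ (@GRing.mul R)) => //; exact: mul_bil_continuous.
have kI := IH (Ck_onS kf).
apply: (mulCk); first exact: mulCk.
by apply: mulCk; [exact: Ck_on_cst|exact: Df].
Qed.

End CalculusRules.

(** * Symmetry of second derivatives *)

Section Schwarz.
Context {R : realType} {V : normedModType R}.

Lemma is_derive_line (F : V -> R) y v (t : R) :
  differentiable F (y + t *: v) ->
  is_derive t 1 (fun t : R => F (y + t *: v)) ('D_v F (y + t *: v)).
Proof.
move=> dF.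
have dl : is_diff t (fun t : R => y + t *: v) (fun h => h *: v).
  by apply: is_diff_eq; rewrite add0r.
have dc : differentiable (fun t : R => F (y + t *: v)) t.
  by apply: (@differentiable_comp _ _ _ _ (fun t : R => y + t *: v) F).
apply: DeriveDef; first exact: diff_derivable.
rewrite !deriveE //.
rewrite (@diff_comp _ _ _ _ (fun t : R => y + t *: v) F) //=.
by rewrite diff_val scale1r.
Qed.

Lemma line_MVT (F : V -> R) y v (h : R) : 0 < h ->
  (forall t, 0 <= t <= h -> differentiable F (y + t *: v)) ->
  exists2 t, 0 < t < h & F (y + h *: v) - F y = h * 'D_v F (y + t *: v).
Proof.
move=> h0 dF.
have [| |t th E] := @MVT _ (fun t : R => F (y + t *: v))
    (fun t => 'D_v F (y + t *: v)) 0 h h0.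
- move=> t /[!in_itv]/= /andP[t0 th]; apply: is_derive_line.
  by apply: dF; rewrite !ltW.
- apply: derivable_within_continuous => t /[!in_itv]/= th.
  exact: (@ex_derive _ _ _ _ _ _ _ (is_derive_line (dF t th))).
exists t; first by move: th; rewrite in_itv.
by rewrite scale0r addr0 subr0 mulrC in E.
Qed.

Lemma derive_translate (F : V -> R) y c v :
  'D_v (fun x => F (x + c)) y = 'D_v F (y + c).
Proof.
rewrite /derive; set G := fun h => _; set G' := fun h => _.
suff -> : G = G' by [].
by apply/funext => h; rewrite /G /G' /= addrA.
Qed.

(** The mean value theorem, used in the direction a and then in the direction b,
    writes the second difference of f as h ^ 2 times a value of the second
    derivative at a point that tends to x. As the left-hand side is symmetric in a
    and b, the two mixed derivatives at x agree. *)
Lemma second_difference (U : set V) (f : V -> R) x a b e :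
  open U -> Ck_on 2 U f -> U x -> 0 < e ->
  \forall h \near (0 : R)^'+, exists2 c,
    `|c - 'D_b (fun y => 'D_a f y) x| < e &
    f (x + h *: a + h *: b) - f (x + h *: a) - f (x + h *: b) + f x = h ^+ 2 * c.
Proof.
move=> oU [df Df] Ux e0.
have [dDf cDf] := Df a; have := cDf b x Ux.
move=> /cvgrPdist_lt/(_ e e0) gx.
have /nbhs_ballP[r /= r0 rP] : \forall y \near x, U y /\
    `|'D_b (fun y => 'D_a f y) x - 'D_b (fun y => 'D_a f y) y| < e.
  by near=> y; split; near: y => //; exact: open_near.
pose C := `|a| + `|b| + 1.
have C0 : 0 < C by rewrite ltr_wpDl // addr_ge0.
near=> h.
have h0 : 0 < h by near: h; exact: nbhs_right_gt.
have hr : h < r / C by near: h; apply: nbhs_right_lt; rewrite divr_gt0.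
have good s t : 0 <= s <= h -> 0 <= t <= h -> ball x r (x + s *: a + t *: b).
  move=> /andP[s0 sh] /andP[t0 th].
  rewrite -ball_normE /= -addrA opprD addNKr normrN.
  apply: le_lt_trans (ler_normD _ _) _; rewrite !normrZ !ger0_norm //.
  rewrite ltr_pdivlMr // in hr; apply: le_lt_trans hr.
  rewrite /C !mulrDr mulr1 -[leLHS]addr0 lerD ?(ltW h0) //.
  by rewrite lerD // ler_wpM2r.
have hh : 0 <= h <= h by apply/andP; split=> //; exact: ltW.
have h00 : (0 : R) <= 0 <= h by apply/andP; split=> //; exact: ltW.
have dfs s t : 0 <= s <= h -> 0 <= t <= h ->
    differentiable f (x + s *: a + t *: b).
  by move=> sh th; apply: df; have [] := rP _ (good s t sh th).
have dfs0 s : 0 <= s <= h -> differentiable f (x + s *: a).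
  by move=> sh; have := dfs s 0 sh h00; rewrite scale0r addr0.
pose F y := f (y + h *: b) - f y.
have dFh y : differentiable f (y + h *: b) ->
    differentiable (fun y => f (y + h *: b)) y.
  by move=> dfy; apply: (@differentiable_comp _ _ _ _ (fun y => y + h *: b) f) => //.
have [s /andP[s0 sh] E] : exists2 s, 0 < s < h &
    F (x + h *: a) - F x = h * 'D_a F (x + s *: a).
  apply: line_MVT => // s sh; apply: differentiableB; last exact: dfs0.
  by apply: dFh; exact: dfs.
have sI : 0 <= s <= h by rewrite !ltW.
have EF : 'D_a F (x + s *: a) =
    'D_a f (x + s *: a + h *: b) - 'D_a f (x + s *: a).
  rewrite deriveB ?derive_translate //; apply: diff_derivable.
    by apply: dFh; exact: dfs.
  exact: dfs0.
have [t /andP[t0 th] E'] : exists2 t, 0 < t < h &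
    'D_a f (x + s *: a + h *: b) - 'D_a f (x + s *: a) =
    h * 'D_b (fun y => 'D_a f y) (x + s *: a + t *: b).
  apply: line_MVT => // t th.
  by apply: dDf; have [] := rP _ (good s t sI th).
exists ('D_b (fun y => 'D_a f y) (x + s *: a + t *: b)).
  by rewrite distrC; have [|] // := rP _ (good s t sI _); rewrite !ltW.
move: E; rewrite EF E' /F => E.
by rewrite expr2 -mulrA -E; ring.
Unshelve. all: by end_near. Qed.

Lemma derive_symmetric_real (U : set V) (f : V -> R) x v w :
  open U -> Ck_on 2 U f -> U x ->
  'D_v (fun y => 'D_w f y) x = 'D_w (fun y => 'D_v f y) x.
Proof.
move=> oU C2 Ux; apply/eqP; rewrite -subr_eq0 -normr_le0.
apply/ler_addgt0Pr => e e0; rewrite add0r.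
have e2 : 0 < e / 2 by rewrite divr_gt0.
have H1 := second_difference v w oU C2 Ux e2.
have H2 := second_difference w v oU C2 Ux e2.
have : \forall h \near (0 : R)^'+,
  `|'D_v (fun y => 'D_w f y) x - 'D_w (fun y => 'D_v f y) x| <= e.
  near=> h.
  have h0 : 0 < h by near: h; exact: nbhs_right_gt.
  have [c1 l1 E1] : exists2 c, `|c - 'D_w (fun y => 'D_v f y) x| < e / 2 &
    f (x + h *: v + h *: w) - f (x + h *: v) - f (x + h *: w) + f x = h ^+ 2 * c.
    by near: h.
  have [c2 l2 E2] : exists2 c, `|c - 'D_v (fun y => 'D_w f y) x| < e / 2 &
    f (x + h *: w + h *: v) - f (x + h *: w) - f (x + h *: v) + f x = h ^+ 2 * c.
    by near: h.
  have c12 : c1 = c2.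
    have h20 : h ^+ 2 != 0 by rewrite expf_neq0 // gt_eqF.
    apply: (mulfI h20).
    by rewrite -E1 -E2 (addrAC x); ring.
  rewrite -c12 in l2; rewrite distrC in l2; rewrite -(subrKA c1).
  by apply: le_trans (ler_normD _ _) _; rewrite (splitr e) lerD ?ltW.
by move=> /filter_ex[].
Unshelve. all: by end_near. Qed.

Lemma derive0_ball_cst (f : V -> R) x r y :
  (forall z, ball x r z -> differentiable f z) ->
  (forall z v, ball x r z -> 'D_v f z = 0) ->
  ball x r y -> f y = f x.
Proof.
move=> df Df xy.
have seg t : 0 <= t <= 1 -> ball x r (x + t *: (y - x)).
  move=> /andP[t0 t1]; move: xy; rewrite -ball_normE /= opprD addNKr normrN.
  rewrite distrC; apply: le_lt_trans.
  by rewrite normrZ ger0_norm // ler_piMl.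
have [t /andP[t0 t1]] := @line_MVT f x (y - x) 1 ltr01 (fun t th => df _ (seg t th)).
rewrite Df; last by apply: seg; rewrite !ltW.
by rewrite mulr0 scale1r [x + _]addrC subrK => /subr0_eq.
Qed.

End Schwarz.

(** * The ambient pseudo-Hermitian space *)

Section Ambient.
Context {R : realType} {n : nat} (s : space_form).
Local Notation E := ('rV[R]_n.+1 * 'rV[R]_n.+1)%type.
Local Notation frm := (@ambient_form R n s).
Local Notation J := (@Jmul R n s).
Local Notation e := (@eps R s).
Local Notation q := (@quadric_level R s).
Implicit Types (x y z : E) (a : R).

Lemma eps_sq : e * e = 1.
Proof. by rewrite /eps; case: s => *; rewrite ?mulr1 ?mulrNN ?mulr1. Qed.

Lemma level_sq : q * q = 1.
Proof.
by rewrite /quadric_level; case: s => [p b||]; rewrite ?mulr1 ?mulrNN ?mulr1 //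
  -expr2 sqrr_sign.
Qed.

(** With these signs the complex and the para-complex forms have one formula, and
    every later argument treats the two cases at once through [eps]. *)
Definition signature (j : 'I_n.+1) : R :=
  if s is CP p _ then (-1) ^+ (j < p)%N else 1.

Lemma unit_neq0 (k : R) : k * k = 1 -> k != 0.
Proof.
by move=> k2; apply: contra_eq_neq k2 => ->; rewrite mul0r eq_sym oner_eq0.
Qed.

Lemma unit_inv (k : R) : k * k = 1 -> k^-1 = k.
Proof. by move=> k2; apply: (mulfI (unit_neq0 k2)); rewrite k2 mulfV ?unit_neq0. Qed.

Lemma ambient_formE x y :
  frm x y = \sum_j signature j * (x.1 0 j * y.1 0 j + e * (x.2 0 j * y.2 0 j)).
Proof.
rewrite /ambient_form /eps /signature; case: s => *; apply: eq_bigr => j _.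
- by rewrite mul1r.
- by rewrite mul1r mulN1r.
- by rewrite mul1r mulN1r.
Qed.

Lemma form_is_bilinear :
  bilinear_for (GRing.Scale.Law.clone _ _ *:%R _)
    (GRing.Scale.Law.clone _ _ *:%R _) (frm : E -> E -> R).
Proof.
have scl a (b c : R) : a *: b + c = a * b + c by [].
by split=> z a x y; rewrite !ambient_formE scl mulr_sumr -big_split;
  apply: eq_bigr => j _; rewrite !mxE /=; ring.
Qed.

HB.instance Definition _ :=
  bilinear_isBilinear.Build R E E R _ _ frm form_is_bilinear.

Definition form_bilinear : {bilinear E -> E -> R} := frm.

Lemma formC x y : frm x y = frm y x.
Proof. by rewrite !ambient_formE; apply: eq_bigr => j _; ring. Qed.

Lemma formDl x y z : frm (x + y) z = frm x z + frm y z.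
Proof. exact: linearDl. Qed.
Lemma formDr x y z : frm x (y + z) = frm x y + frm x z.
Proof. exact: linearDr. Qed.
Lemma formNl x y : frm (- x) y = - frm x y.
Proof. exact: linearNl. Qed.
Lemma formNr x y : frm x (- y) = - frm x y.
Proof. exact: linearNr. Qed.
Lemma formZl a x y : frm (a *: x) y = a * frm x y.
Proof. exact: linearZl_LR. Qed.
Lemma formZr a x y : frm x (a *: y) = a * frm x y.
Proof. exact: linearZr_LR. Qed.
Lemma form0l x : frm 0 x = 0.
Proof. exact: linear0l. Qed.
Lemma form0r x : frm x 0 = 0.
Proof. exact: linear0r. Qed.

Lemma form_continuous : continuous (fun p : E * E => frm p.1 p.2).
Proof.
pose c1 j (x : E) : R := x.1 0 j; pose c2 j (x : E) : R := x.2 0 j.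
have k1 j : continuous (c1 j).
  move=> x; apply: (@continuous_comp _ _ _ fst (fun M : 'rV[R]_n.+1 => M 0 j)).
    exact: cvg_fst.
  exact: coord_cont.
have k2 j : continuous (c2 j).
  move=> x; apply: (@continuous_comp _ _ _ snd (fun M : 'rV[R]_n.+1 => M 0 j)).
    exact: cvg_snd.
  exact: coord_cont.
have f1 (g : E -> R) : continuous g -> continuous (fun p : E * E => g p.1).
  by move=> cg p; apply: (@continuous_comp _ _ _ fst g); [exact: cvg_fst|exact: cg].
have f2 (g : E -> R) : continuous g -> continuous (fun p : E * E => g p.2).
  by move=> cg p; apply: (@continuous_comp _ _ _ snd g); [exact: cvg_snd|exact: cg].
rewrite (_ : (fun p => _) = fun p : E * E => \sum_j signature j *
  (c1 j p.1 * c1 j p.2 + e * (c2 j p.1 * c2 j p.2))); last first.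
  by apply/funext => p; rewrite ambient_formE.
move=> p; apply: (cvg_big (op := +%R)) => [|j _]; first exact: add_continuous.
apply: cvgMl_tmp; apply: cvgD; last apply: cvgMl_tmp.
  by apply: cvgM; [apply: (f1 _ (k1 j))|apply: (f2 _ (k1 j))].
by apply: cvgM; [apply: (f1 _ (k2 j))|apply: (f2 _ (k2 j))].
Qed.

Lemma form_nondegenerate x : (forall y, frm x y = 0) -> x = 0.
Proof.
move=> x0.
have sg0 j : signature j != 0.
  by rewrite /signature; case: s => *; rewrite ?oner_neq0 ?signr_eq0.
have e0 : e != 0 := unit_neq0 eps_sq.
case: x x0 => x1 x2 x0; congr pair; apply/rowP => j; rewrite mxE.
  have := x0 (delta_mx 0 j, 0); rewrite ambient_formE (bigD1 j) //= big1 => [|i ij].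
    rewrite !mxE !eqxx /= mulr1 mulr0 mulr0 !addr0 => /eqP.
    by rewrite mulf_eq0 (negPf (sg0 j)) => /eqP.
  by rewrite !mxE (negPf ij) /= !mulr0 addr0 mulr0.
have := x0 (0, delta_mx 0 j); rewrite ambient_formE (bigD1 j) //= big1 => [|i ij].
  rewrite !mxE !eqxx /= mulr1 mulr0 add0r addr0 => /eqP.
  by rewrite !mulf_eq0 (negPf (sg0 j)) (negPf e0) => /eqP.
by rewrite !mxE (negPf ij) /= !mulr0 addr0 mulr0.
Qed.

Lemma form_ext x y : (forall w, frm x w = frm y w) -> x = y.
Proof.
move=> xy; apply/eqP; rewrite -subr_eq0; apply/eqP.
by apply: form_nondegenerate => w; rewrite formDl formNl xy subrr.
Qed.

Lemma JmulE x : J x = (- e *: x.2, x.1).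
Proof.
by rewrite /Jmul /scal /= scale0r sub0r scale0r add0r mulr1 scale1r scaleNr.
Qed.

Lemma J_linear : linear J.
Proof.
move=> a x y; rewrite !JmulE /=; congr pair => /=.
by rewrite scalerDr !scalerA mulrC.
Qed.

HB.instance Definition _ := GRing.isLinear.Build R E E _ J J_linear.

Lemma J_continuous : continuous J.
Proof.
move=> x; have -> : J = (fun x => (- e *: x.2, x.1)) by apply/funext=> y; exact: JmulE.
have c1 : - e *: y.2 @[y --> x] --> - e *: x.2.
  by apply: cvgZl_tmp; exact: cvg_snd.
have c2 : y.1 @[y --> x] --> x.1 by exact: cvg_fst.
exact: cvg_pair c1 c2.
Qed.

Lemma JJ x : J (J x) = - e *: x.
Proof. by rewrite !JmulE /=; case: x. Qed.

Lemma JD x y : J (x + y) = J x + J y. Proof. exact: linearD. Qed.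
Lemma JN x : J (- x) = - J x. Proof. exact: linearN. Qed.
Lemma JZ a x : J (a *: x) = a *: J x. Proof. exact: linearZ. Qed.

Lemma formJJ x y : frm (J x) (J y) = e * frm x y.
Proof.
rewrite !ambient_formE mulr_sumr; apply: eq_bigr => j _; rewrite !JmulE !mxE /=.
by have e2 := eps_sq; ring: e2.
Qed.

Lemma formJl x y : frm (J x) y = - frm x (J y).
Proof.
rewrite !ambient_formE -sumrN; apply: eq_bigr => j _; rewrite !JmulE !mxE /=.
ring.
Qed.

Lemma form_Jskew x y : frm x (J y) = - frm y (J x).
Proof. by rewrite -formJl formC. Qed.

Lemma formJ_skew x y : frm (J x) y = - frm (J y) x.
Proof. by rewrite formJl formC. Qed.

Lemma formxJ x : frm x (J x) = 0.
Proof. by have := formJl x x; rewrite formC; lra. Qed.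

Lemma inj_surj k (f : 'rV[R]_k -> E) : linear f -> k = (n.+1 + n.+1)%N ->
  (forall X, f X = 0 -> X = 0) -> forall v, exists X, f X = v.
Proof.
move=> lf kE f0 v.
pose g (X : 'rV[R]_k) := row_mx (f X).1 (f X).2.
have lg : linear g.
  by move=> a X Y; rewrite /g lf /= scale_row_mx add_row_mx.
pose gl : {linear _ -> _} := HB.pack g (GRing.isLinear.Build _ _ _ _ g lg).
have gE X : g X = X *m lin1_mx gl by rewrite mul_rV_lin1.
have free : row_free (lin1_mx gl).
  apply: inj_row_free => X; rewrite -gE /g => gX0; apply: f0.
  have [f1 f2] : (f X).1 = 0 /\ (f X).2 = 0.
    by apply: eq_row_mx; rewrite gX0 row_mx0.
  by case: (f X) f1 f2 => ? ? /= -> ->.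
have full : row_full (lin1_mx gl).
  by rewrite /row_full (eqP free); apply/eqP.
have /submxP[X XE] := submx_full (row_mx v.1 v.2) full.
exists X; move: XE; rewrite -gE /g => /eq_row_mx[].
by case: v {full} => v1 v2 /=; case: (f X) => ? ? /= -> ->.
Qed.

(** Four linear conditions on a space of dimension 2n + 2 >= 6. *)
Lemma exists_orthogonal (n_ge2 : (2 <= n)%N) (a b c d : E) :
  exists2 v : E, v != 0 &
    [/\ frm v a = 0, frm v b = 0, frm v c = 0 & frm v d = 0].
Proof.
pose g (X : 'rV[R]_(n.+1 + n.+1)) : 'rV[R]_4 :=
  \row_i frm (lsubmx X, rsubmx X) (nth 0 [:: a; b; c; d] i).
have lg : linear g.
  by move=> k X Y; apply/rowP => i; rewrite !mxE -formZl -formDl; congr frm; rewrite !linearP.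
pose gl : {linear _ -> _} := HB.pack g (GRing.isLinear.Build _ _ _ _ g lg).
have : kermx (lin1_mx gl) != 0.
  rewrite -mxrank_eq0 mxrank_ker -lt0n subn_gt0.
  apply: leq_ltn_trans (rank_leq_col _) _.
  by rewrite addSn addnS; apply: ltnW; rewrite !ltnS (leq_add n_ge2 n_ge2).
move=> /rowV0Pn[X /sub_kermxP]; rewrite mul_rV_lin1 /= => gX X0.
have gi i (i4 : (i < 4)%N) : frm (lsubmx X, rsubmx X) (nth 0 [:: a; b; c; d] i) = 0.
  by have /rowP/(_ (Ordinal i4)) := gX; rewrite !mxE.
exists (lsubmx X, rsubmx X).
  apply: contra_neq X0 => -[l0 r0]; by rewrite -(hsubmxK X) l0 r0 row_mx0.
by split; [exact: (gi 0)|exact: (gi 1)|exact: (gi 2)|exact: (gi 3)].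
Qed.

End Ambient.

(** * Smooth maps into the ambient space *)

Section SmoothOn.
Context {R : realType} {V : normedModType R} {n : nat} (s : space_form).
Local Notation E := ('rV[R]_n.+1 * 'rV[R]_n.+1)%type.
Local Notation frm := (@ambient_form R n s).
Local Notation J := (@Jmul R n s).
Context (U : set V) (oU : open U).
Implicit Types (a b : V -> R) (f g : V -> E) (u v : V).

Lemma smooth_differentiable (W : normedModType R) (f : V -> W) u :
  smooth_on U f -> U u -> differentiable f u.
Proof. by move=> sf Uu; have [df _] := sf 1%N; exact: df. Qed.

Lemma smooth_derive (W : normedModType R) (f : V -> W) v :
  smooth_on U f -> smooth_on U (fun u => 'D_v f u).
Proof. by move=> sf k; have [_] := sf k.+1; apply. Qed.

Lemma smooth_eq (W : normedModType R) (f g : V -> W) :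
  (forall u, U u -> f u = g u) -> smooth_on U f -> smooth_on U g.
Proof. by move=> fg sf k; apply: Ck_on_eq (sf k). Qed.

Lemma smooth_cst (W : normedModType R) (c : W) : smooth_on U (fun=> c).
Proof. by move=> k; exact: Ck_on_cst. Qed.

Lemma smooth_add (W : normedModType R) (f g : V -> W) :
  smooth_on U f -> smooth_on U g -> smooth_on U (fun u => f u + g u).
Proof. by move=> sf sg k; apply: Ck_onD. Qed.

Lemma smooth_scale (W : normedModType R) a (f : V -> W) :
  smooth_on U a -> smooth_on U f -> smooth_on U (fun u => a u *: f u).
Proof.
move=> sf sg k; exact: (@Ck_on_bil R V R W W (@GRing.scale R W)
  (@scale_bil_continuous _ _) k U a f oU (sf k) (sg k)).
Qed.

Lemma smooth_mul a b :
  smooth_on U a -> smooth_on U b -> smooth_on U (fun u => a u * b u).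
Proof.
move=> sf sg k; exact: (@Ck_on_bil R V R R R (@GRing.mul R) mul_bil_continuous
  k U a b oU (sf k) (sg k)).
Qed.

Lemma smooth_opp (W : normedModType R) (f : V -> W) :
  smooth_on U f -> smooth_on U (fun u => - f u).
Proof.
move=> sf; apply: (smooth_eq (f := fun u => (fun=> -1 : R) u *: f u)).
  by move=> u _; rewrite scaleN1r.
by apply: smooth_scale => //; exact: smooth_cst.
Qed.

Lemma smooth_form f g :
  smooth_on U f -> smooth_on U g -> smooth_on U (fun u => frm (f u) (g u)).
Proof.
move=> sf sg k.
exact: (@Ck_on_bil R V E E R (form_bilinear s) (@form_continuous _ _ s)
  k U f g oU (sf k) (sg k)).
Qed.

Lemma smooth_J f : smooth_on U f -> smooth_on U (fun u => J (f u)).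
Proof.
move=> sf k; exact: (@Ck_on_lin R V E E J (@J_linear _ _ s) (@J_continuous _ _ s)
  k U f oU (sf k)).
Qed.

Lemma smooth_inv a : (forall u, U u -> a u != 0) -> smooth_on U a ->
  smooth_on U (fun u => (a u)^-1).
Proof. by move=> a0 sa k; apply: Ck_on_inv. Qed.

Lemma derive_eq_on (W : normedModType R) (f g : V -> W) u v :
  (forall u, U u -> f u = g u) -> U u -> 'D_v f u = 'D_v g u.
Proof.
move=> fg Uu; apply: near_eq_derive.
by apply: filterS (open_near oU Uu) => y Uy; apply: fg.
Qed.

Lemma derive_cst_on (W : normedModType R) (f : V -> W) c u v :
  (forall u, U u -> f u = c) -> U u -> 'D_v f u = 0.
Proof. by move=> fc Uu; rewrite (derive_eq_on v fc Uu); exact: derive_cst. Qed.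

Lemma derive_linear (W : normedModType R) (f : V -> W) (u : V) (c : R) v w :
  differentiable f u -> 'D_(c *: v + w) f u = c *: 'D_v f u + 'D_w f u.
Proof. by move=> df; rewrite !deriveE // linearP. Qed.

Lemma derive_add (W : normedModType R) (f g : V -> W) u v :
  differentiable f u -> differentiable g u ->
  'D_v (fun u => f u + g u) u = 'D_v f u + 'D_v g u.
Proof. by move=> df dg; rewrite -deriveD //; apply: diff_derivable. Qed.

Lemma derive_bigsum (W : normedModType R) d (f : 'I_d -> V -> W) u v :
  (forall j, differentiable (f j) u) ->
  'D_v (fun t => \sum_j f j t) u = \sum_j 'D_v (f j) u.
Proof.
move=> df; rewrite -derive_sum => [|j]; last exact: diff_derivable.
by congr ('D_ _ _ _); apply/funext => x; rewrite fct_sumE.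
Qed.

Lemma derive_opp (W : normedModType R) (f : V -> W) u v :
  differentiable f u -> 'D_v (fun u => - f u) u = - 'D_v f u.
Proof. by move=> df; rewrite -deriveN //; apply: diff_derivable. Qed.

Lemma derive_scale (W : normedModType R) a (f : V -> W) u v :
  differentiable a u -> differentiable f u ->
  'D_v (fun u => a u *: f u) u = 'D_v a u *: f u + a u *: 'D_v f u.
Proof.
move=> da df.
have := @derive_bil R V R W W (@GRing.scale R W) (@scale_bil_continuous _ _)
  a f u v da df.
by move=> ->.
Qed.

Lemma derive_scalel (W : normedModType R) (c : R) (f : V -> W) u v :
  differentiable f u -> 'D_v (fun u => c *: f u) u = c *: 'D_v f u.
Proof. by move=> df; rewrite -deriveZ //; exact: diff_derivable. Qed.

Lemma derive_mul a b u v : differentiable a u -> differentiable b u ->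
  'D_v (fun u => a u * b u) u = 'D_v a u * b u + a u * 'D_v b u.
Proof.
move=> da db.
have := @derive_bil R V R R R (@GRing.mul R) mul_bil_continuous a b u v da db.
by move=> ->.
Qed.

Lemma derive_mull c a u v : differentiable a u ->
  'D_v (fun u => c * a u) u = c * 'D_v a u.
Proof.
move=> da; rewrite (@derive_mul (fun=> c)) //.
by rewrite (derive_cst c) mul0r add0r.
Qed.

Lemma derive_form f g u v : differentiable f u -> differentiable g u ->
  'D_v (fun u => frm (f u) (g u)) u = frm ('D_v f u) (g u) + frm (f u) ('D_v g u).
Proof.
move=> df dg.
have := @derive_bil R V E E R (form_bilinear s) (@form_continuous _ _ s) f g u v df dg.
by move=> ->.
Qed.

Lemma derive_J f u v :
  differentiable f u -> 'D_v (fun u => J (f u)) u = J ('D_v f u).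
Proof.
move=> df.
by have -> :=
  @derive_lin R V E E J (@J_linear _ _ s) (@J_continuous _ _ s) f u v df.
Qed.

(** Pairing with constant vectors reduces the statement to real functions. *)
Lemma derive_symmetric f u v w : smooth_on U f -> U u ->
  'D_v (fun y => 'D_w f y) u = 'D_w (fun y => 'D_v f y) u.
Proof.
move=> sf Uu; apply/eqP; rewrite -subr_eq0; apply/eqP.
apply: (@form_nondegenerate _ _ s) => c; apply/eqP.
rewrite formDl formNl subr_eq0; apply/eqP.
have fc : smooth_on U (fun u => frm (f u) c).
  by apply: smooth_form => //; exact: smooth_cst.
have D1 (g : V -> E) x y : smooth_on U g -> U y ->
    'D_x (fun u => frm (g u) c) y = frm ('D_x g y) c.
  move=> sg Uy; rewrite (@derive_form g (fun=> c)).
  - by rewrite (derive_cst c) form0r addr0.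
  - exact: smooth_differentiable.
  - exact: differentiable_cst.
have D2 x y : 'D_x (fun u => 'D_y (fun u => frm (f u) c) u) u =
    frm ('D_x (fun u => 'D_y f u) u) c.
  rewrite -(D1 (fun u => 'D_y f u)) //; last exact: smooth_derive.
  by apply: derive_eq_on => // t Ut; exact: D1.
have := derive_symmetric_real v w oU (fc 2%N) Uu.
by rewrite !D2.
Qed.

Lemma derive_symmetricR a u v w : smooth_on U a -> U u ->
  'D_v (fun y => 'D_w a y) u = 'D_w (fun y => 'D_v a y) u.
Proof. by move=> sf Uu; exact: derive_symmetric_real oU (sf 2%N) Uu. Qed.

Lemma smooth_open_neq (f : V -> R) c :
  smooth_on U f -> open (U `&` [set u | f u != c]).
Proof.
move=> sf; rewrite openE => u [Uu fu]; rewrite /interior.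
have h1 := open_near oU Uu.
have h2 : \forall y \near u, f y != c.
  have cf : f y @[y --> u] --> f u by exact: (sf 0%N u Uu).
  by apply: (cf [set y | y != c]); apply: open_nbhs_nbhs; split=> //; exact: open_neq.
exact: filterI h1 h2.
Qed.

End SmoothOn.

Lemma smooth_sub {R : realType} {V W : normedModType R} (U U' : set V)
  (f : V -> W) : U' `<=` U -> smooth_on U f -> smooth_on U' f.
Proof. by move=> UU sf k; exact: Ck_on_sub (sf k). Qed.

Lemma smooth_comp {R : realType} {V W : normedModType R} {d} (U : set V)
  (U' : set 'rV[R]_d) (f : 'rV[R]_d -> W) (g : V -> 'rV[R]_d) :
  open U -> g @` U `<=` U' -> smooth_on U' f -> smooth_on U g ->
  smooth_on U (fun u => f (g u)).
Proof. by move=> oU gU sf sg k; exact: Ck_on_comp gU (sf k) (sg k). Qed.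

(** * Algebra of the shape operator *)

Section ShapeAlgebra.
Context {R : realType} {n : nat} (s : space_form).
Local Notation E := ('rV[R]_n.+1 * 'rV[R]_n.+1)%type.
Local Notation "<< x , y >>" := (@ambient_form R n s x y).
Local Notation J := (@Jmul R n s).
Local Notation e := (@eps R s).
Local Notation q := (@quadric_level R s).
Variables (z N : E) (d : R).
Hypothesis d2 : d * d = 1.
Hypothesis ff : (<< z, z >> = q) * (<< N, N >> = d) *
  (<< N, z >> = 0) * (<< N, J z >> = 0) *
  (<< z, N >> = 0) * (<< z, J N >> = 0) *
  (<< z, J z >> = 0) * (<< N, J N >> = 0).
Let e2 := @eps_sq R s.
Let q2 := @level_sq R s.

(** [horth] describes the orthogonal complement H of the complex plane spanned by
    z and N, and [hpart] is the projection onto it. *)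
Definition horth v := << v, z >> = 0 /\ << v, J z >> = 0 /\
  << v, N >> = 0 /\ << v, J N >> = 0.

Definition hpart (x : E) : E :=
  x + - ((q * << x, z >>) *: z + (e * q * << x, J z >>) *: J z
  + (d * << x, N >>) *: N + (e * d * << x, J N >>) *: J N).

Lemma horth_rev v : horth v -> (<< z, v >> = 0) * (<< z, J v >> = 0) *
  (<< N, v >> = 0) * (<< N, J v >> = 0) * (<< v, z >> = 0) *
  (<< v, J z >> = 0) * (<< v, N >> = 0) * (<< v, J N >> = 0).
Proof.
move=> [vz [vJz [vN vJN]]]; do !split => //; rewrite formC ?formJl //.
  by rewrite vJz oppr0.
by rewrite vJN oppr0.
Qed.

Lemma horthJ v : horth v -> horth (J v).
Proof.
move=> /horth_rev o; do !split; rewrite formJl ?JJ ?formZr !o; ring.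
Qed.

Lemma horthD v w : horth v -> horth w -> horth (v + w).
Proof.
by move=> /horth_rev o /horth_rev o'; do !split; rewrite formDl !o !o' addr0.
Qed.

Lemma horthZ c v : horth v -> horth (c *: v).
Proof. by move=> /horth_rev o; do !split; rewrite formZl !o mulr0. Qed.

Lemma horth_hpart x : horth (hpart x).
Proof.
rewrite /hpart; do !split;
  rewrite !(formDl, formNl, formZl, formJJ, formJl) !ff;
  rewrite ?formJl ?ff; ring: e2 q2 d2.
Qed.

Lemma form_hpart v x : horth v -> << x, v >> = << hpart x, v >>.
Proof.
move=> /horth_rev o; rewrite /hpart !(formDl, formNl, formZl, formJl) !o; ring.
Qed.

Lemma form_split x y : << x, y >> = << hpart x, hpart y >> +
  (q * (<< x, z >> * << y, z >>) +
   e * q * (<< x, J z >> * << y, J z >>) +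
   d * (<< x, N >> * << y, N >>) +
   e * d * (<< x, J N >> * << y, J N >>)).
Proof.
rewrite -(form_hpart x (horth_hpart y)) /hpart formDr formNr !formDr !formZr.
ring.
Qed.

Lemma form_split_of x y x1 x2 x3 x4 y1 y2 y3 y4 :
  << x, z >> = x1 -> << x, J z >> = x2 -> << x, N >> = x3 -> << x, J N >> = x4 ->
  << y, z >> = y1 -> << y, J z >> = y2 -> << y, N >> = y3 -> << y, J N >> = y4 ->
  << x, y >> = << hpart x, hpart y >> +
  (q * (x1 * y1) + e * q * (x2 * y2) + d * (x3 * y3) + e * d * (x4 * y4)).
Proof.
by move=> <- <- <- <- <- <- <- <-; exact: form_split.
Qed.

(** In the application T is the space of coordinate directions at a point, and
    [be X] is the image of [al X] under a shape operator S of H. The three identities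
    say that S is symmetric, anticommutes with J, and has square - q d. *)
Variables (T : Type) (al be : T -> E).
Hypothesis al_orth : forall X, horth (al X).
Hypothesis be_orth : forall X, horth (be X).
Hypothesis al_surj : forall v, horth v -> exists X, al X = v.
Hypothesis al_be : forall X Y, << al X, be Y >> = << al Y, be X >>.
Hypothesis al_Jbe : forall X Y, << al X, J (be Y) >> = << al Y, J (be X) >>.
Hypothesis be_Jbe : forall X Y,
  << be X, J (be Y) >> = q * d * << al X, J (al Y) >>.

Lemma horth_nondegenerate v : horth v -> (forall X, << v, al X >> = 0) -> v = 0.
Proof.
move=> ov v0; apply: (@form_nondegenerate _ _ s) => y.
have [X XE] := al_surj (horth_hpart y).
by rewrite formC (form_hpart _ ov) -XE formC v0.
Qed.

Lemma horth_ext v w : horth v -> horth w ->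
  (forall X, << v, al X >> = << w, al X >>) -> v = w.
Proof.
move=> ov ow vw; apply/eqP; rewrite -subr_eq0; apply/eqP.
apply: horth_nondegenerate => [|X].
  by rewrite -scaleN1r; apply: horthD => //; exact: horthZ.
by rewrite formDl formNl vw subrr.
Qed.

(** < X, S Y > and < X, J S Y > are both symmetric while J is skew, so moving J
    across S costs a sign: S J = - J S. *)
Lemma be_alJ X Y : al Y = J (al X) -> be Y = - J (be X).
Proof.
move=> YE; apply: horth_ext => // [|Z].
  by rewrite -scaleN1r; apply/horthZ/horthJ.
rewrite formC al_be YE formJl al_Jbe formNl; congr (- _); exact: formC.
Qed.

Lemma be_be X Y : << be X, be Y >> = - (q * d) * << al X, al Y >>.
Proof.
have [W WE] := al_surj (horthJ (al_orth Y)).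
have := be_Jbe X W; rewrite (be_alJ WE) WE JN !JJ formNr !formZr.
have alg (x y : R) : - (- e * x) = q * d * (- e * y) -> x = - (q * d) * y.
  move=> /(congr1 (fun k => e * k)) E1.
  have {E1} : (e * e) * x = (e * e) * (- (q * d) * y) by move: E1; lra.
  by rewrite e2 !mul1r.
exact: alg.
Qed.

(** [shifts Y Y'] says that [al Y'] is the image of [al Y] under S. *)
Definition shifts Y Y' := al Y' = be Y /\ be Y' = - (q * d) *: al Y.

Lemma exists_shift Y : exists Y', shifts Y Y'.
Proof.
have [Y' YE] := al_surj (be_orth Y); exists Y'; split=> //.
apply: horth_ext => // [|Z]; first exact: horthZ.
by rewrite formZl formC al_be YE be_be.
Qed.

(** For p, r in H with images p', r' under S, and x, x' with images y, y', this is
    the pairing of the second fundamental forms of H in the ambient space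
    that enters < R(x, x') S p - S R(x, x') p, r > in the Gauss equation. *)
Definition curv x y x' y' p p' r r' :=
  q * (<< p', x >> * << r, x' >> - << p, x >> * << r', x' >>) +
  e * q * (<< p', J x >> * << r, J x' >> - << p, J x >> * << r', J x' >>) +
  d * (<< p', y >> * << r, y' >> - << p, y >> * << r', y' >>) +
  e * d * (<< p', J y >> * << r, J y' >> - << p, J y >> * << r', J y' >>).

(** This is the pairing with [al Z] of the statement that S commutes with the
    curvature of H. *)
Hypothesis curv_identity : forall X V Y Z,
  4 * (e * q) * << al V, J (al X) >> * << J (be Y), al Z >> +
  (curv (al X) (be X) (al V) (be V) (al Y) (be Y) (al Z) (be Z) -
   curv (al V) (be V) (al X) (be X) (al Y) (be Y) (al Z) (be Z)) = 0.

(** Write x = [al X], y = S x and r = <x, x>, p = <x, y>, t = <x, J y>. The curvature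
    identity for the directions x and J x, applied to x and paired with x, J x
    and J y, gives 12 q r t = 0, 12 e q r p = 0 and
    - 8 e d r ^ 2 + 4 e q p ^ 2 + 4 q t ^ 2 = 0, hence r = 0. *)
Lemma null_al X : << al X, al X >> = 0.
Proof.
have [V VE] := al_surj (horthJ (al_orth X)).
have VB := be_alJ VE.
have [X' [X'a X'b]] := exists_shift X.
have [W WE] := al_surj (horthJ (al_orth X')).
have WB := be_alJ WE; rewrite X'a in WE; rewrite X'b in WB.
have yy := be_be X X.
have xJx := formxJ s (al X); have yJy := formxJ s (be X).
have yx := formC s (be X) (al X).
have yJx : << be X, J (al X) >> = - << al X, J (be X) >>.
  by rewrite -formJl formC.
have E1 := curv_identity X V X X.
have E2 := curv_identity X V X V.
have E3 := curv_identity X V X W.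
rewrite /curv VE VB in E1; rewrite /curv VE VB in E2; rewrite /curv VE VB WE WB in E3.
move: E1 E2 E3 yy xJx yJy yx yJx.
move: (al X) (be X) => x y.
rewrite !(JN, JZ, JJ, formNl, formNr, formZl, formZr, formJl).
move=> E1 E2 E3 yy xJx yJy yx yJx; move: E1 E2 E3.
rewrite xJx yJy yx yJx yy.
set r := << x, x >>; set p := << x, y >>; set t := << x, J y >>.
move=> E1 E2 E3.
have F1 : 12 * q * (r * t) = 0 by rewrite -E1; ring: e2 q2 d2.
have F2 : 12 * (e * q) * (r * p) = 0 by rewrite -E2; ring: e2 q2 d2.
have F3 : - 8 * (e * d) * r ^+ 2 + 4 * (e * q) * p ^+ 2 + 4 * q * t ^+ 2 = 0.
  by rewrite -E3; ring: e2 q2 d2.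
have [//|r0] := eqVneq r 0.
have t0 : t = 0.
  apply/eqP; move/eqP: F1; rewrite !mulf_eq0 (negPf r0) (negPf (unit_neq0 q2)).
  by rewrite pnatr_eq0.
have p0 : p = 0.
  apply/eqP; move/eqP: F2; rewrite !mulf_eq0 (negPf r0) (negPf (unit_neq0 q2)).
  by rewrite (negPf (unit_neq0 e2)) pnatr_eq0.
move/eqP: F3; rewrite t0 p0 expr0n /= !mulr0 !addr0 !mulf_eq0 oppr_eq0.
rewrite (negPf (unit_neq0 d2)) (negPf (unit_neq0 e2)) pnatr_eq0 /=.
by rewrite (negPf r0).
Qed.

(** All vectors of H are null, so the form vanishes on H by polarization, whereas it
    is nondegenerate there. *)
Lemma horth_eq0 v : horth v -> v = 0.
Proof.
have null x : horth x -> << x, x >> = 0.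
  by move=> /al_surj[X <-]; exact: null_al.
move=> ov; apply: horth_nondegenerate => // X.
have := null _ (horthD ov (al_orth X)); have := null _ (al_orth X).
have := null _ ov; rewrite !(formDl, formDr) (formC s (al X)); lra.
Qed.
End ShapeAlgebra.

(** * Moving frame of a lifted hypersurface *)

Ltac smooth_step := first
  [ assumption | exact: smooth_cst
  | apply: smooth_add | apply: smooth_opp | apply: smooth_scale
  | apply: smooth_mul | apply: smooth_form | apply: smooth_J
  | apply: smooth_derive ].

Section Frame.
Context {R : realType} {V : normedModType R} {n : nat} (s : space_form).
Local Notation E := ('rV[R]_n.+1 * 'rV[R]_n.+1)%type.
Local Notation "<< x , y >>" := (@ambient_form R n s x y).
Local Notation J := (@Jmul R n s).
Local Notation e := (@eps R s).
Local Notation q := (@quadric_level R s).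
Variables (z N : V -> E) (d : R).

(** Components of dz and dN in the frame z, J z, N, J N completed by its orthogonal
    complement H: [tau] is the connection form of the fibration of the quadric,
    [eta] the 1-form dual to the structure vector, [sig] the J N-component of dN,
    and [alp], [bet] are the parts in H. *)
Definition tau X u := e * q * << 'D_X z u, J (z u) >>.
Definition eta X u := - d * << 'D_X z u, J (N u) >>.
Definition sig X u := e * d * << 'D_X N u, J (N u) >>.
Definition alp X u : E :=
  'D_X z u + - tau X u *: J (z u) + (e * eta X u) *: J (N u).
Definition bet X u : E :=
  'D_X N u + - sig X u *: J (N u) + (d * e * q * eta X u) *: J (z u).

Lemma alpE X u : alp X u =
  'D_X z u + - tau X u *: J (z u) + (e * eta X u) *: J (N u).
Proof. by []. Qed.

Lemma betE X u : bet X u =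
  'D_X N u + - sig X u *: J (N u) + (d * e * q * eta X u) *: J (z u).
Proof. by []. Qed.

(** z is a local lift to the quadric of a hypersurface and N the horizontal lift of
    its unit normal. By [lift_full] the horizontal vectors orthogonal to N
    are the horizontal parts of the derivatives of z. *)
Record lifted_hypersurface (U : set V) : Prop := LiftedHypersurface {
  lift_open : open U;
  lift_sign : d * d = 1;
  lift_smooth : smooth_on U z;
  lift_smoothN : smooth_on U N;
  lift_level : forall u, U u -> << z u, z u >> = q;
  lift_Nz : forall u, U u -> << N u, z u >> = 0;
  lift_NJz : forall u, U u -> << N u, J (z u) >> = 0;
  lift_unit : forall u, U u -> << N u, N u >> = d;
  lift_normal : forall X u, U u -> << 'D_X z u, N u >> = 0;
  lift_full : forall u v, U u -> << v, z u >> = 0 -> << v, J (z u) >> = 0 ->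
    << v, N u >> = 0 -> exists X, 'D_X z u + - tau X u *: J (z u) = v }.

Section OnU.
Variables (U : set V).
Hypothesis H : lifted_hypersurface U.
Let oU := lift_open H.
Let d2 := lift_sign H.
Let sz := lift_smooth H.
Let sN := lift_smoothN H.
Let e2 := @eps_sq R s.
Let q2 := @level_sq R s.

Local Ltac smooth := repeat (smooth_step; try exact: oU).
Local Ltac diffble Uu := apply: (@smooth_differentiable _ _ U) Uu; smooth.

Lemma smooth_tau X : smooth_on U (tau X).
Proof. by rewrite /tau; smooth. Qed.
Lemma smooth_eta X : smooth_on U (eta X).
Proof. by rewrite /eta; smooth. Qed.
Lemma smooth_sig X : smooth_on U (sig X).
Proof. by rewrite /sig; smooth. Qed.

Lemma smooth_alp X : smooth_on U (alp X).
Proof.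
have := smooth_tau X; have := smooth_eta X => se st.
by rewrite /alp; smooth.
Qed.
Lemma smooth_bet X : smooth_on U (bet X).
Proof.
have := smooth_sig X; have := smooth_eta X => se st.
by rewrite /bet; smooth.
Qed.

Section AtPoint.
Variable u : V.
Hypothesis Uu : U u.

Lemma dz_z X : << 'D_X z u, z u >> = 0.
Proof.
have := derive_cst_on oU X (lift_level H) Uu.
rewrite derive_form; [|by diffble Uu..].
rewrite [<< z u, _ >>]formC; lra.
Qed.

Lemma dz_Jz X : << 'D_X z u, J (z u) >> = e * q * tau X u.
Proof. by rewrite /tau; ring: e2 q2. Qed.

Lemma dz_JN X : << 'D_X z u, J (N u) >> = - d * eta X u.
Proof. by rewrite /eta; ring: d2. Qed.

Lemma dz_N X : << 'D_X z u, N u >> = 0.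
Proof. exact: (lift_normal H). Qed.

Lemma dN_N X : << 'D_X N u, N u >> = 0.
Proof.
have := derive_cst_on oU X (lift_unit H) Uu.
rewrite derive_form; [|by diffble Uu..].
rewrite [<< N u, _ >>]formC; lra.
Qed.

Lemma dN_z X : << 'D_X N u, z u >> = 0.
Proof.
have := derive_cst_on oU X (lift_Nz H) Uu.
rewrite derive_form; [|by diffble Uu..].
have := formC s (N u) ('D_X z u); have := dz_N X; lra.
Qed.

Lemma dN_Jz X : << 'D_X N u, J (z u) >> = - d * eta X u.
Proof.
have := derive_cst_on oU X (lift_NJz H) Uu.
rewrite derive_form; [|by diffble Uu..].
rewrite derive_J; last by diffble Uu.
have := formC s (N u) (J ('D_X z u)); have := formJl s ('D_X z u) (N u).
have := dz_JN X; lra.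
Qed.

Lemma dN_JN X : << 'D_X N u, J (N u) >> = e * d * sig X u.
Proof. by rewrite /sig; ring: e2 d2. Qed.

Let zz := lift_level H Uu.
Let NN := lift_unit H Uu.
Let Nz := lift_Nz H Uu.
Let NJz := lift_NJz H Uu.
Let zN : << z u, N u >> = 0. Proof. by rewrite formC. Qed.
Let zJN : << z u, J (N u) >> = 0. Proof. by rewrite formC formJl NJz oppr0. Qed.
Let zJz := @formxJ _ _ s (z u).
Let NJN := @formxJ _ _ s (N u).

Lemma frame_forms : (<< z u, z u >> = q) * (<< N u, N u >> = d) *
  (<< N u, z u >> = 0) * (<< N u, J (z u) >> = 0) *
  (<< z u, N u >> = 0) * (<< z u, J (N u) >> = 0) *
  (<< z u, J (z u) >> = 0) * (<< N u, J (N u) >> = 0).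
Proof. by do !split. Qed.

Lemma alp_z X : << alp X u, z u >> = 0.
Proof.
rewrite /alp !(formDl, formZl, formJl) !frame_forms dz_z; ring.
Qed.
Lemma alp_Jz X : << alp X u, J (z u) >> = 0.
Proof.
rewrite /alp !(formDl, formZl, formJJ) !frame_forms dz_Jz; ring.
Qed.
Lemma alp_N X : << alp X u, N u >> = 0.
Proof.
rewrite /alp !(formDl, formZl, formJl) !frame_forms dz_N; ring.
Qed.
Lemma alp_JN X : << alp X u, J (N u) >> = 0.
Proof.
rewrite /alp !(formDl, formZl, formJJ) !frame_forms dz_JN; ring: e2.
Qed.
Lemma bet_z X : << bet X u, z u >> = 0.
Proof.
rewrite /bet !(formDl, formZl, formJl) !frame_forms dN_z; ring.
Qed.
Lemma bet_Jz X : << bet X u, J (z u) >> = 0.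
Proof.
rewrite /bet !(formDl, formZl, formJJ) !frame_forms dN_Jz; ring: e2 q2.
Qed.
Lemma bet_N X : << bet X u, N u >> = 0.
Proof.
rewrite /bet !(formDl, formZl, formJl) !frame_forms dN_N; ring.
Qed.
Lemma bet_JN X : << bet X u, J (N u) >> = 0.
Proof.
rewrite /bet !(formDl, formZl, formJJ) !frame_forms dN_JN; ring: e2.
Qed.

Local Notation horth := (@horth R n s (z u) (N u)).

Lemma orth_alp X : horth (alp X u).
Proof. by split; [|split; [|split]]; rewrite ?alp_z ?alp_Jz ?alp_N ?alp_JN. Qed.
Lemma orth_bet X : horth (bet X u).
Proof. by split; [|split; [|split]]; rewrite ?bet_z ?bet_Jz ?bet_N ?bet_JN. Qed.

Lemma dzE X : 'D_X z u =
  alp X u + tau X u *: J (z u) + (- e * eta X u) *: J (N u).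
Proof.
by rewrite /alp mulNr !scaleNr (addrAC (_ - _)) subrK addrK.
Qed.

Lemma dNE X : 'D_X N u =
  bet X u + sig X u *: J (N u) + (- (d * e * q) * eta X u) *: J (z u).
Proof.
by rewrite /bet mulNr !scaleNr (addrAC (_ - _)) subrK addrK.
Qed.

(** Pairings of derivatives of z and N with J reduce to H: J maps J z, J N to
    multiples of z, N, to which all the derivatives are orthogonal. *)
Lemma frame_pairJ a b t k t' k' : horth a -> horth b ->
  << a + t *: J (z u) + k *: J (N u),
     J (b + t' *: J (z u) + k' *: J (N u)) >> = << a, J b >>.
Proof.
move=> /horth_rev oa /horth_rev ob.
rewrite !(JD, JZ, JJ, formDl, formDr, formZl, formZr, formJl, formNr, formNl).
rewrite !frame_forms !oa !ob; ring.
Qed.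

Lemma frame_pair a b t k t' k' : horth a -> horth b ->
  << a + t *: J (z u) + k *: J (N u), b + t' *: J (z u) + k' *: J (N u) >> =
  << a, b >> + e * q * (t * t') + e * d * (k * k').
Proof.
move=> /horth_rev oa /horth_rev ob.
rewrite !(JD, JZ, JJ, formDl, formDr, formZl, formZr, formJl, formNr, formNl).
rewrite !frame_forms !oa !ob; ring.
Qed.

Lemma dNE' X : 'D_X N u =
  bet X u + (- (d * e * q) * eta X u) *: J (z u) + sig X u *: J (N u).
Proof. by rewrite dNE addrAC. Qed.

Lemma dz_Jdz X Y : << 'D_X z u, J ('D_Y z u) >> = << alp X u, J (alp Y u) >>.
Proof. by rewrite (dzE X) (dzE Y); apply: frame_pairJ; exact: orth_alp. Qed.

Lemma dN_JdN X Y : << 'D_X N u, J ('D_Y N u) >> = << bet X u, J (bet Y u) >>.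
Proof. by rewrite (dNE' X) (dNE' Y); apply: frame_pairJ; exact: orth_bet. Qed.

Lemma dz_JdN X Y : << 'D_X z u, J ('D_Y N u) >> = << alp X u, J (bet Y u) >>.
Proof.
rewrite (dzE X) (dNE' Y).
by apply: frame_pairJ; [exact: orth_alp|exact: orth_bet].
Qed.

Let exterior_d (k t1 t2 s1 s2 p1 p2 a b : R) :
  t1 = k * (s1 + p1) -> t2 = k * (s2 + p2) -> s1 = s2 -> p1 = a -> p2 = b ->
  t1 - t2 = k * (a - b).
Proof. by move=> -> -> -> -> ->; ring. Qed.

Lemma derive_pairJ (f g : V -> E) k A : smooth_on U f -> smooth_on U g ->
  'D_A (fun y => k * << f y, J (g y) >>) u =
   k * (<< 'D_A f u, J (g u) >> + << f u, J ('D_A g u) >>).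
Proof.
move=> sf sg; rewrite derive_mull; last by diffble Uu.
rewrite derive_form; [|by diffble Uu..].
by rewrite derive_J; last by diffble Uu.
Qed.

Let skew_diff k (a b : R) : b = - a -> k * (b - a) = - 2 * k * a.
Proof. by move=> ->; ring. Qed.

(** The three structure equations come from the symmetry of the second derivatives
    of z and N: only the products of two first derivatives survive
    antisymmetrization. *)
Lemma d_tau X Y : 'D_X (tau Y) u - 'D_Y (tau X) u =
  - 2 * (e * q) * << alp X u, J (alp Y u) >>.
Proof.
have D A B := derive_pairJ (e * q) A (smooth_derive B sz) sz.
have S := congr1 (fun v => << v, J (z u) >>) (derive_symmetric s oU X Y sz Uu).
apply: etrans (exterior_d (D X Y) (D Y X) S (dz_Jdz Y X) (dz_Jdz X Y)) _.
exact: skew_diff (form_Jskew s _ _).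
Qed.

Lemma d_eta X Y : 'D_X (eta Y) u - 'D_Y (eta X) u =
  d * (<< alp X u, J (bet Y u) >> - << alp Y u, J (bet X u) >>).
Proof.
have D A B := derive_pairJ (- d) A (smooth_derive B sz) sN.
have S := congr1 (fun v => << v, J (N u) >>) (derive_symmetric s oU X Y sz Uu).
apply: etrans (exterior_d (D X Y) (D Y X) S (dz_JdN Y X) (dz_JdN X Y)) _.
by rewrite mulNr -mulrN opprB.
Qed.

Lemma d_sig X Y : 'D_X (sig Y) u - 'D_Y (sig X) u =
  - 2 * (e * d) * << bet X u, J (bet Y u) >>.
Proof.
have D A B := derive_pairJ (e * d) A (smooth_derive B sN) sN.
have S := congr1 (fun v => << v, J (N u) >>) (derive_symmetric s oU X Y sN Uu).
apply: etrans (exterior_d (D X Y) (D Y X) S (dN_JdN Y X) (dN_JdN X Y)) _.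
exact: skew_diff (form_Jskew s _ _).
Qed.

(** Both sides are - < D_X D_Y z, N >. *)
Lemma dz_dN X Y : << 'D_X z u, 'D_Y N u >> = << 'D_Y z u, 'D_X N u >>.
Proof.
have D A B : << 'D_A (fun y => 'D_B z y) u, N u >> + << 'D_B z u, 'D_A N u >> = 0.
  rewrite -derive_form; [|by diffble Uu..].
  by apply: (derive_cst_on oU A _ Uu) => t Ut; exact: (lift_normal H).
have cancel (s1 s2 p1 p2 : R) : s1 + p1 = 0 -> s2 + p2 = 0 -> s1 = s2 -> p2 = p1.
  by move=> E1 E2 E3; lra.
have S := congr1 (fun v => << v, N u >>) (derive_symmetric s oU X Y sz Uu).
exact: cancel (D X Y) (D Y X) S.
Qed.

Lemma shape_symmetric X Y :
  << alp X u, bet Y u >> - d * (eta X u * sig Y u + tau X u * eta Y u) =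
  << alp Y u, bet X u >> - d * (eta Y u * sig X u + tau Y u * eta X u).
Proof.
have alg (p t1 h1 h2 s2 : R) :
    p + e * q * (t1 * (- (d * e * q) * h2)) + e * d * (- e * h1 * s2) =
    p - d * (h1 * s2 + t1 * h2) by ring: e2 q2.
have P A B : << 'D_A z u, 'D_B N u >> =
    << alp A u, bet B u >> - d * (eta A u * sig B u + tau A u * eta B u).
  rewrite (dzE A) (dNE' B) frame_pair; [|exact: orth_alp|exact: orth_bet].
  exact: alg.
exact: etrans (etrans (esym (P X Y)) (dz_dN X Y)) (P Y X).
Qed.

End AtPoint.

(** The structure vector xi satisfies A xi = c xi: the equations on [alp] and [eta]
    characterize xi, those on [bet] and [sig] say that it is principal. *)
Definition Hopf_vector u X c :=
  [/\ alp X u = 0, bet X u = 0, eta X u = 1 & sig X u - tau X u = e * c].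

(** Symmetry of the shape operator, tested on xi. *)
Lemma Hopf_sig u xi c X : U u -> Hopf_vector u xi c ->
  sig X u - tau X u = e * c * eta X u.
Proof.
move=> Uu [a0 b0 h1 <-]; have := shape_symmetric Uu X xi.
rewrite a0 b0 h1 form0l form0r.
have alg (hX sX tX sx tx : R) :
    0 - d * (hX * sx + tX * 1) = 0 - d * (1 * sX + tx * hX) ->
    sX - tX = (sx - tx) * hX.
  move=> E1; have : d * (d * (sX - tX)) = d * (d * ((sx - tx) * hX)).
    by congr (d * _); lra.
  by rewrite !mulrA d2 !mul1r.
exact: alg.
Qed.

Lemma bet_symmetric u xi c X Y : U u -> Hopf_vector u xi c ->
  << alp X u, bet Y u >> = << alp Y u, bet X u >>.
Proof.
move=> Uu Hx.
have alg (A B hX hY sX sY tX tY k : R) : sX - tX = k * hX -> sY - tY = k * hY ->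
    A - d * (hX * sY + tX * hY) = B - d * (hY * sX + tY * hX) -> A = B.
  by move=> /eqP; rewrite subr_eq => /eqP -> /eqP; rewrite subr_eq => /eqP -> ; lra.
exact: alg (Hopf_sig X Uu Hx) (Hopf_sig Y Uu Hx) (shape_symmetric Uu X Y).
Qed.

End OnU.
End Frame.

(** * Parallelism of the shape operator when eta is closed *)

Section ParallelShape.
Context {R : realType} {V : normedModType R} {n : nat} (s : space_form).
Local Notation E := ('rV[R]_n.+1 * 'rV[R]_n.+1)%type.
Local Notation "<< x , y >>" := (@ambient_form R n s x y).
Local Notation J := (@Jmul R n s).
Local Notation e := (@eps R s).
Local Notation q := (@quadric_level R s).
Variables (U : set V) (z N : V -> E) (d : R).
Variables (tau sig eta : V -> V -> R) (al be : V -> V -> E).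
Hypotheses (oU : open U) (d2 : d * d = 1).
Hypotheses (sz : smooth_on U z) (sN : smooth_on U N).
Hypotheses (stau : forall X, smooth_on U (tau X))
  (ssig : forall X, smooth_on U (sig X)) (seta : forall X, smooth_on U (eta X))
  (sal : forall X, smooth_on U (al X)) (sbe : forall X, smooth_on U (be X)).
Hypothesis ff : forall u, U u ->
  (<< z u, z u >> = q) * (<< N u, N u >> = d) *
  (<< N u, z u >> = 0) * (<< N u, J (z u) >> = 0) *
  (<< z u, N u >> = 0) * (<< z u, J (N u) >> = 0) *
  (<< z u, J (z u) >> = 0) * (<< N u, J (N u) >> = 0).
Hypothesis dz : forall X u, U u -> 'D_X z u =
  al X u + tau X u *: J (z u) + (- e * eta X u) *: J (N u).
Hypothesis dN : forall X u, U u -> 'D_X N u =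
  be X u + (- (d * e * q) * eta X u) *: J (z u) + sig X u *: J (N u).
Local Notation horth u := (@horth R n s (z u) (N u)).
Hypothesis al_orth : forall u, U u -> forall X, horth u (al X u).
Hypothesis be_orth : forall u, U u -> forall X, horth u (be X u).
Hypothesis al_surj : forall u, U u -> forall v, horth u v -> exists X, al X u = v.
Hypothesis al_be : forall u, U u -> forall X Y,
  << al X u, be Y u >> = << al Y u, be X u >>.
Hypothesis al_Jbe : forall u, U u -> forall X Y,
  << al X u, J (be Y u) >> = << al Y u, J (be X u) >>.
Hypothesis be_Jbe : forall u, U u -> forall X Y,
  << be X u, J (be Y u) >> = q * d * << al X u, J (al Y u) >>.
Hypothesis d_tau : forall u, U u -> forall X Y,
  'D_X (tau Y) u - 'D_Y (tau X) u = - 2 * (e * q) * << al X u, J (al Y u) >>.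
Hypothesis d_sig : forall u, U u -> forall X Y,
  'D_X (sig Y) u - 'D_Y (sig X) u = - 2 * (e * q) * << al X u, J (al Y u) >>.
Let e2 := @eps_sq R s.
Let q2 := @level_sq R s.
Let be_be u (Uu : U u) := be_be d2 (ff Uu) (al_orth Uu) (be_orth Uu)
  (al_surj Uu) (al_be Uu) (al_Jbe Uu) (be_Jbe Uu).
Let exists_shift u (Uu : U u) := exists_shift d2 (ff Uu) (al_orth Uu)
  (be_orth Uu) (al_surj Uu) (al_be Uu) (al_Jbe Uu) (be_Jbe Uu).
Local Notation shifts u Y Y' :=
  (al Y' u = be Y u /\ be Y' u = - (q * d) *: al Y u).

Local Ltac smooth := repeat (smooth_step; try exact: oU).
Local Ltac diffble Uu := apply: (@smooth_differentiable _ _ U) Uu; smooth.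

(** The connection f |-> D f - nu J f on maps into the ambient space. Its curvature
    is a multiple of J, it is compatible with the form, and the choice of nu
    halfway between [tau] and [sig] makes the Codazzi equation of the shape
    operator free of [tau], [sig] and [eta]. *)
Definition nu A u := 2^-1 * (tau A u + sig A u).
Definition cD A (f : V -> E) u : E := 'D_A f u + - nu A u *: J (f u).

Lemma smooth_nu A : smooth_on U (nu A).
Proof. by have ? := stau A; have ? := ssig A; rewrite /nu; smooth. Qed.

Lemma smooth_cD A f : smooth_on U f -> smooth_on U (cD A f).
Proof. by move=> sf; have ? := smooth_nu A; rewrite /cD; smooth. Qed.

Section AtPoint.
Variable u : V.
Hypothesis Uu : U u.

Lemma derive_form_cD (f g : V -> E) A : smooth_on U f -> smooth_on U g ->
  'D_A (fun y => << f y, g y >>) u = << cD A f u, g u >> + << f u, cD A g u >>.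
Proof.
move=> sf sg; rewrite derive_form; [|by diffble Uu..].
rewrite /cD; move: ('D_A f u) ('D_A g u) => x y.
by rewrite formDl formDr formZl formZr formJl; ring.
Qed.

Lemma d_nu X Y : 'D_X (nu Y) u - 'D_Y (nu X) u =
  - 2 * (e * q) * << al X u, J (al Y u) >>.
Proof.
have D A B : 'D_A (nu B) u = 2^-1 * ('D_A (tau B) u + 'D_A (sig B) u).
  have ? := stau B; have ? := ssig B.
  rewrite /nu derive_mull; last by diffble Uu.
  by rewrite derive_add; [|by diffble Uu..].
have alg (n1 n2 t1 t2 s1 s2 c : R) : n1 = 2^-1 * (t1 + s1) ->
    n2 = 2^-1 * (t2 + s2) -> t1 - t2 = c -> s1 - s2 = c -> n1 - n2 = c.
  by move=> -> -> E1 E2; lra.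
exact: alg (D X Y) (D Y X) (d_tau Uu X Y) (d_sig Uu X Y).
Qed.

Lemma cD_commute f X Y w : smooth_on U f ->
  << cD X (cD Y f) u, w >> - << cD Y (cD X f) u, w >> =
  2 * (e * q) * << al X u, J (al Y u) >> * << J (f u), w >>.
Proof.
move=> sf.
have D A B : cD A (cD B f) u = 'D_A (fun y => 'D_B f y) u +
    (- 'D_A (nu B) u *: J (f u) + - nu B u *: J ('D_A f u)) +
    - nu A u *: J ('D_B f u + - nu B u *: J (f u)).
  have sB := smooth_nu B.
  rewrite {1}/cD derive_add; [|by diffble Uu..].
  rewrite derive_scale; [|by diffble Uu..].
  rewrite derive_opp; last by diffble Uu.
  by rewrite derive_J; last by diffble Uu.
have alg (a a' f0 fx fy : E) (p p' k l c : R) : a = a' -> p - p' = - c ->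
    << a + (- p *: J f0 + - k *: J fx) + - l *: J (fy + - k *: J f0), w >> -
    << a' + (- p' *: J f0 + - l *: J fy) + - k *: J (fx + - l *: J f0), w >> =
    c * << J f0, w >>.
  move=> -> pp; rewrite !(JD, JZ, JJ, formDl, formZl, formNl).
  have -> : c = p' - p by lra.
  by ring.
rewrite (D X Y) (D Y X).
apply: alg; first exact: (derive_symmetric s oU X Y sf Uu).
by rewrite d_nu; ring.
Qed.

Lemma form_dz w X : horth u w -> << w, 'D_X z u >> = << w, al X u >>.
Proof.
by move=> /horth_rev o; rewrite dz // !formDr !formZr !o !mulr0 !addr0.
Qed.

Lemma form_Jdz w X : horth u w -> << w, J ('D_X z u) >> = << w, J (al X u) >>.
Proof.
move=> /horth_rev o.
by rewrite dz // !JD !JZ !JJ !formDr !formZr !o !mulr0 !addr0.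
Qed.

Lemma form_dN w X : horth u w -> << w, 'D_X N u >> = << w, be X u >>.
Proof.
by move=> /horth_rev o; rewrite dN // !formDr !formZr !o !mulr0 !addr0.
Qed.

Lemma form_JdN w X : horth u w -> << w, J ('D_X N u) >> = << w, J (be X u) >>.
Proof.
move=> /horth_rev o.
by rewrite dN // !JD !JZ !JJ !formDr !formZr !o !mulr0 !addr0.
Qed.

(** The components of the derivative of a map f into H along the frame are those of
    the second fundamental form of H. *)
Section NormalComponents.
Variable f : V -> E.
Hypothesis sf : smooth_on U f.
Hypothesis fH : forall y, U y -> horth y (f y).
Variable X : V.

Let component (g : V -> E) : smooth_on U g ->
  (forall y, U y -> << f y, g y >> = 0) -> << f u, J (g u) >> = 0 ->
  << cD X f u, g u >> = - << f u, 'D_X g u >>.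
Proof.
move=> sg fg fJg; have := derive_cst_on oU X fg Uu.
rewrite (derive_form_cD X sf sg) [in cD X g u]/cD formDr formZr fJg => E1.
by apply/eqP; rewrite -subr_eq0 opprK -E1 mulr0 addr0.
Qed.

Let o := horth_rev (fH Uu).

Lemma cD_z : << cD X f u, z u >> = - << f u, al X u >>.
Proof.
rewrite component ?o //; first by rewrite form_dz //; exact: fH.
by move=> y Uy; rewrite (horth_rev (fH Uy)).
Qed.

Lemma cD_Jz : << cD X f u, J (z u) >> = - << f u, J (al X u) >>.
Proof.
rewrite (component (g := fun y => J (z y))); first last.
- by rewrite JJ formZr o mulr0.
- by move=> y Uy; rewrite (horth_rev (fH Uy)).
- by smooth.
by rewrite derive_J ?form_Jdz //; [exact: fH|diffble Uu].
Qed.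

Lemma cD_N : << cD X f u, N u >> = - << f u, be X u >>.
Proof.
rewrite component ?o //; first by rewrite form_dN //; exact: fH.
by move=> y Uy; rewrite (horth_rev (fH Uy)).
Qed.

Lemma cD_JN : << cD X f u, J (N u) >> = - << f u, J (be X u) >>.
Proof.
rewrite (component (g := fun y => J (N y))); first last.
- by rewrite JJ formZr o mulr0.
- by move=> y Uy; rewrite (horth_rev (fH Uy)).
- by smooth.
by rewrite derive_J ?form_JdN //; [exact: fH|diffble Uu].
Qed.
End NormalComponents.

Lemma form_horth_sum w (x y y' : E) (p k p' k' : R) : horth u w ->
  << w, x + (p *: J (z u) + k *: y + (p' *: J (N u) + k' *: y')) >> =
  << w, x >> + (k * << w, y >> + k' * << w, y' >>).
Proof.
by move=> /horth_rev o; rewrite !formDr !formZr !o !mulr0 !add0r.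
Qed.

Lemma form_d_al w X Y : horth u w -> << w, 'D_X (al Y) u >> =
  << w, 'D_X (fun y => 'D_Y z y) u >> +
  (- tau Y u * << w, J (al X u) >> + e * eta Y u * << w, J (be X u) >>).
Proof.
move=> ow; have aux x y y' p k p' k' := form_horth_sum x y y' p k p' k' ow.
have alE y : U y ->
    al Y y = 'D_Y z y + (- tau Y y *: J (z y) + (e * eta Y y) *: J (N y)).
  by move=> Uy; rewrite dz // mulNr !scaleNr addrACA addrK addNr addr0.
have st := stau Y; have se := seta Y.
rewrite (derive_eq_on oU X alE Uu).
rewrite derive_add; [|by diffble Uu..].
rewrite derive_add; [|by diffble Uu..].
rewrite (@derive_scale _ _ E); [|by diffble Uu..].
rewrite (@derive_scale _ _ E); [|by diffble Uu..].
rewrite derive_J; last by diffble Uu.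
rewrite derive_J; last by diffble Uu.
apply: etrans (aux _ _ _ _ _ _ _) _.
by congr (_ + (_ * _ + _ * _)); [exact: form_Jdz|exact: form_JdN].
Qed.

Lemma form_d_be w X Y : horth u w -> << w, 'D_X (be Y) u >> =
  << w, 'D_X (fun y => 'D_Y N y) u >> +
  (d * e * q * eta Y u * << w, J (al X u) >> + - sig Y u * << w, J (be X u) >>).
Proof.
move=> ow; have aux x y y' p k p' k' := form_horth_sum x y y' p k p' k' ow.
have beE y : U y -> be Y y =
    'D_Y N y + ((d * e * q * eta Y y) *: J (z y) + - sig Y y *: J (N y)).
  by move=> Uy; rewrite dN // mulNr !scaleNr addrACA subrK subrr addr0.
have ss := ssig Y; have se := seta Y.
rewrite (derive_eq_on oU X beE Uu).
rewrite derive_add; [|by diffble Uu..].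
rewrite derive_add; [|by diffble Uu..].
rewrite (@derive_scale _ _ E); [|by diffble Uu..].
rewrite (@derive_scale _ _ E); [|by diffble Uu..].
rewrite derive_J; last by diffble Uu.
rewrite derive_J; last by diffble Uu.
apply: etrans (aux _ _ _ _ _ _ _) _.
by congr (_ + (_ * _ + _ * _)); [exact: form_Jdz|exact: form_JdN].
Qed.

Lemma codazzi_al w X Y : horth u w ->
  << w, cD X (al Y) u >> - << w, cD Y (al X) u >> =
  (tau X u - nu X u) * << w, J (al Y u) >>
  - (tau Y u - nu Y u) * << w, J (al X u) >>
  + e * (eta Y u * << w, J (be X u) >> - eta X u * << w, J (be Y u) >>).
Proof.
move=> ow.
have D A B : << w, cD A (al B) u >> = _ :=
  etrans (formDr s _ _ _) (congr2 +%R (form_d_al A B ow) (formZr s _ _ _)).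
have S := congr1 (fun v => << w, v >>) (derive_symmetric s oU X Y sz Uu).
have alg (x y a a' k1 k2 k3 k4 m1 m2 m3 m4 l l' : R) : a = a' ->
    x = a + (k1 * m1 + k2 * m2) + l * m3 -> y = a' + (k3 * m3 + k4 * m4) + l' * m1 ->
    x - y = k1 * m1 + k2 * m2 - (k3 * m3 + k4 * m4) + l * m3 - l' * m1.
  by move=> -> -> ->; ring.
apply: etrans (alg _ _ _ _ _ _ _ _ _ _ _ _ _ _ S (D X Y) (D Y X)) _.
by ring.
Qed.

Lemma codazzi_be w X Y : horth u w ->
  << w, cD X (be Y) u >> - << w, cD Y (be X) u >> =
  (sig X u - nu X u) * << w, J (be Y u) >>
  - (sig Y u - nu Y u) * << w, J (be X u) >>
  + d * e * q * (eta Y u * << w, J (al X u) >> - eta X u * << w, J (al Y u) >>).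
Proof.
move=> ow.
have D A B : << w, cD A (be B) u >> = _ :=
  etrans (formDr s _ _ _) (congr2 +%R (form_d_be A B ow) (formZr s _ _ _)).
have S := congr1 (fun v => << w, v >>) (derive_symmetric s oU X Y sN Uu).
have alg (x y a a' k1 k2 k3 k4 m1 m2 m3 m4 l l' : R) : a = a' ->
    x = a + (k1 * m1 + k2 * m2) + l * m4 -> y = a' + (k3 * m3 + k4 * m4) + l' * m2 ->
    x - y = k1 * m1 + k2 * m2 - (k3 * m3 + k4 * m4) + l * m4 - l' * m2.
  by move=> -> -> ->; ring.
apply: etrans (alg _ _ _ _ _ _ _ _ _ _ _ _ _ _ S (D X Y) (D Y X)) _.
by ring.
Qed.

(** The covariant derivative of S as a cubic form: [cubic X Y Z] is
    < (D_X S) (al Y), al Z >. *)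
Definition cubic X Y Z y :=
  << cD X (be Y) y, al Z y >> - << cD X (al Y) y, be Z y >>.

Lemma be_Jal Y Z : << be Z u, J (al Y u) >> = - << al Z u, J (be Y u) >>.
Proof. by rewrite (al_Jbe Uu) -formJl formC. Qed.

(** The Codazzi equations of z and N combine to this: the connection was twisted by
    nu, the mean of tau and sig, so that their inhomogeneous terms cancel. *)
Lemma cubic_sym12 X Y Z : cubic X Y Z u = cubic Y X Z u.
Proof.
have E1 := codazzi_be X Y (al_orth Uu Z).
have E2 := codazzi_al X Y (be_orth Uu Z).
rewrite !be_Jal !(be_Jbe Uu) in E2.
rewrite /cubic.
have c1 := formC s (cD X (be Y) u) (al Z u).
have c2 := formC s (cD Y (be X) u) (al Z u).
have c3 := formC s (cD X (al Y) u) (be Z u).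
have c4 := formC s (cD Y (al X) u) (be Z u).
have alg (b1 b2 a1 a2 B1 B2 a3 a4 sx sy tx ty nx ny h1 h2 : R) :
  b1 - b2 = (sx - nx) * B2 - (sy - ny) * B1 + d * e * q * (h2 * a3 - h1 * a4) ->
  a1 - a2 = (tx - nx) * - B2 - (ty - ny) * - B1 +
    e * (h2 * (q * d * a3) - h1 * (q * d * a4)) ->
  nx = 2^-1 * (tx + sx) -> ny = 2^-1 * (ty + sy) ->
  b1 - a1 = b2 - a2.
  move=> F1 F2 F3 F4.
  have : (b1 - b2) - (a1 - a2) = 0 by rewrite F1 F2 F3 F4; field.
  lra.
rewrite c1 c2 c3 c4; apply: alg E1 E2 _ _; by [].
Qed.

(** The derivative of a field of symmetric operators is symmetric. *)
Lemma cubic_sym23 X Y Z : cubic X Y Z u = cubic X Z Y u.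
Proof.
have F y : U y -> << be Y y, al Z y >> + - << al Y y, be Z y >> = 0.
  by move=> Uy; rewrite formC (al_be Uy) subrr.
have := derive_cst_on oU X F Uu.
have ? := sal Y; have ? := sal Z; have ? := sbe Y; have ? := sbe Z.
rewrite derive_add; [|by diffble Uu..].
rewrite derive_opp; last by diffble Uu.
rewrite !derive_form_cD // /cubic.
have c1 := formC s (be Y u) (cD X (al Z) u).
have c2 := formC s (al Y u) (cD X (be Z) u).
by rewrite c1 c2; lra.
Qed.

(** As S ^ 2 is constant, D_X S anticommutes with S. *)
Lemma cubic_shift X Y Z Y' Z' : shifts u Y Y' -> shifts u Z Z' ->
  cubic X Y Z' u = - cubic X Y' Z u.
Proof.
move=> [Y1 Y2] [Z1 Z2]; rewrite (cubic_sym23 X Y' Z) /cubic Y1 Y2 Z1 Z2 !formZr.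
have F y : U y -> << be Y y, be Z y >> + (q * d) * << al Y y, al Z y >> = 0.
  by move=> Uy; rewrite be_be // mulNr addNr.
have := derive_cst_on oU X F Uu.
have ? := sal Y; have ? := sal Z; have ? := sbe Y; have ? := sbe Z.
rewrite derive_add; [|by diffble Uu..].
rewrite derive_mull; last by diffble Uu.
rewrite !derive_form_cD //.
have c1 := formC s (be Y u) (cD X (be Z) u).
have c2 := formC s (al Y u) (cD X (al Z) u).
by rewrite c1 c2; lra.
Qed.

(** By symmetry, moving S between any two of the three arguments changes the sign of
    the cubic form. Going around the three arguments shows that the form vanishes
    when one argument is in the image of S, which is everything. *)
Lemma cubic0 X Y Z : cubic X Y Z u = 0.
Proof.
have sh A : exists A', shifts u A A' by exact: exists_shift.
have first0 A B C A' : shifts u A A' -> cubic A' B C u = 0.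
  move=> hA; have [B' hB] := sh B; have [C' hC] := sh C.
  have E1 : cubic A B C' u = - cubic A B' C u := cubic_shift A hB hC.
  have E2 : cubic B A C' u = - cubic B A' C u := cubic_shift B hA hC.
  have E3 : cubic C B A' u = - cubic C B' A u := cubic_shift C hB hA.
  rewrite (cubic_sym12 B A) (cubic_sym12 B A') in E2.
  rewrite (cubic_sym23 C B) (cubic_sym12 C A') (cubic_sym23 A' C) in E3.
  rewrite (cubic_sym23 C B') (cubic_sym12 C A) (cubic_sym23 A C) in E3.
  by lra.
have [Z' hZ] := sh Z; have [Z'' [Z1 Z2]] := sh Z'.
have := first0 Z' X Y Z'' (conj Z1 Z2).
rewrite (cubic_sym12 Z'') (cubic_sym23 X Z'') /cubic Z1 Z2.
case: hZ => -> ->; rewrite !formZr -mulrBr => /eqP; rewrite mulf_eq0 oppr_eq0.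
move=> /orP[/eqP qd0|/eqP //]; exfalso.
have : (q * q) * (d * d) = 0 by rewrite mulrACA qd0 mul0r.
by rewrite q2 d2 mulr1 => /eqP; rewrite oner_eq0.
Qed.

End AtPoint.

Section CurvatureIdentity.
Variable u : V.
Hypothesis Uu : U u.
Local Notation hpart := (@hpart R n s (z u) (N u) d).

(** Since S is parallel, the H-part of the derivative of S (al Y) is S of the H-part
    of the derivative of al Y. *)
Lemma hpart_cD X Y Y1 : al Y1 u = hpart (cD X (al Y) u) ->
  hpart (cD X (be Y) u) = be Y1 u.
Proof.
move=> Y1E; have hh := horth_hpart d2 (ff Uu).
apply: (horth_ext d2 (ff Uu) (al_surj Uu)) => // [|Z]; first exact: be_orth.
have hal := form_hpart d (cD X (be Y) u) (al_orth Uu Z).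
have hbe := form_hpart d (cD X (al Y) u) (be_orth Uu Z).
have c0 : << cD X (be Y) u, al Z u >> = << cD X (al Y) u, be Z u >>.
  by apply/eqP; rewrite -subr_eq0; apply/eqP; exact: cubic0.
apply: etrans (esym hal) (etrans c0 (etrans hbe _)).
by rewrite -Y1E (al_be Uu); exact: formC.
Qed.

(** The parts in H cancel because S is symmetric and parallel; what remains is the
    product of the second fundamental forms. *)
Lemma form_cD_al_be X V' Y Z :
  << cD X (be Y) u, cD V' (al Z) u >> - << cD X (al Y) u, cD V' (be Z) u >> =
  curv s d (al X u) (be X u) (al V' u) (be V' u) (al Y u) (be Y u) (al Z u) (be Z u).
Proof.
have [Y1 Y1E] := al_surj Uu (horth_hpart d2 (ff Uu) (cD X (al Y) u)).
have [Z1 Z1E] := al_surj Uu (horth_hpart d2 (ff Uu) (cD V' (al Z) u)).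
have Y1B := hpart_cD Y1E; have Z1B := hpart_cD Z1E.
have oa A y (Uy : U y) := al_orth Uy A; have ob A y (Uy : U y) := be_orth Uy A.
have split f g A B (sf : smooth_on U f) (sg : smooth_on U g)
    (hf : forall y, U y -> horth y (f y)) (hg : forall y, U y -> horth y (g y)) :=
  form_split_of d2 (ff Uu) (cD_z Uu sf hf A) (cD_Jz Uu sf hf A)
    (cD_N Uu sf hf A) (cD_JN Uu sf hf A) (cD_z Uu sg hg B) (cD_Jz Uu sg hg B)
    (cD_N Uu sg hg B) (cD_JN Uu sg hg B).
have S1 := split _ _ X V' (sbe Y) (sal Z) (ob Y) (oa Z).
have S2 := split _ _ X V' (sal Y) (sbe Z) (oa Y) (ob Z).
have P1 : << hpart (cD X (be Y) u), hpart (cD V' (al Z) u) >> =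
    << hpart (cD X (al Y) u), hpart (cD V' (be Z) u) >>.
  by rewrite Y1B Z1B -Y1E -Z1E (al_be Uu Y1 Z1) formC.
have alg (x1 x2 p1 p2 r1 r2 r3 : R) : x1 = p1 + r1 -> x2 = p2 + r2 -> p1 = p2 ->
    r1 - r2 = r3 -> x1 - x2 = r3.
  by move=> -> -> -> <-; ring.
apply: alg S1 S2 P1 _; rewrite /curv; ring.
Qed.

(** Antisymmetrized derivative of the equation [cubic0]: the second derivatives
    contribute the curvature of the twisted connection, the products of first
    derivatives are given by [form_cD_al_be]. *)
Lemma shape_curvature X V' Y Z :
  4 * (e * q) * << al V' u, J (al X u) >> * << J (be Y u), al Z u >> +
  (curv s d (al X u) (be X u) (al V' u) (be V' u) (al Y u) (be Y u) (al Z u) (be Z u)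
  - curv s d (al V' u) (be V' u) (al X u) (be X u) (al Y u) (be Y u) (al Z u) (be Z u))
  = 0.
Proof.
rewrite -!form_cD_al_be.
have D A B : << cD A (cD B (be Y)) u, al Z u >> +
    << cD B (be Y) u, cD A (al Z) u >> - (<< cD A (cD B (al Y)) u, be Z u >> +
    << cD B (al Y) u, cD A (be Z) u >>) = 0.
  have F y : U y -> << cD B (be Y) y, al Z y >> + - << cD B (al Y) y, be Z y >> = 0.
    by move=> Uy; exact: cubic0.
  have := derive_cst_on oU A F Uu.
  have ? := smooth_cD B (sal Y); have ? := smooth_cD B (sbe Y).
  have ? := sal Z; have ? := sbe Z.
  rewrite derive_add; [|by diffble Uu..].
  rewrite derive_opp; last by diffble Uu.
  by rewrite !derive_form_cD.
have C1 := cD_commute Uu V' X (al Z u) (sbe Y).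
have C2 := cD_commute Uu V' X (be Z u) (sal Y).
have B1 : << J (al Y u), be Z u >> = - << J (be Y u), al Z u >>.
  by rewrite formJl (al_Jbe Uu) formC.
have alg (a a' b b' g1 g2 g3 g4 m t : R) : a + g1 - (b + g2) = 0 ->
    a' + g3 - (b' + g4) = 0 -> a - a' = m -> b - b' = - m -> t = 2 * m ->
    t + ((g1 - g2) - (g3 - g4)) = 0.
  move=> F1 F2 F3 F4 ->.
  have -> : 2 * m + ((g1 - g2) - (g3 - g4)) = (a + g1 - (b + g2))
      - (a' + g3 - (b' + g4)) - (a - a' - m) + (b - b' + m) by ring.
  by rewrite F1 F2 F3 F4; ring.
apply: alg (D V' X) (D X V') C1 (etrans C2 _) _; first by rewrite B1 mulrN.
by ring.
Qed.
End CurvatureIdentity.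

End ParallelShape.

(** * Hopf hypersurfaces *)

Section HopfFrame.
Context {R : realType} {V : normedModType R} {n : nat} (s : space_form).
Local Notation E := ('rV[R]_n.+1 * 'rV[R]_n.+1)%type.
Local Notation "<< x , y >>" := (@ambient_form R n s x y).
Local Notation J := (@Jmul R n s).
Local Notation e := (@eps R s).
Local Notation q := (@quadric_level R s).
Variables (z N : V -> E) (d : R).
Local Notation tau := (tau s z).
Local Notation sig := (sig s N d).
Local Notation eta := (eta s z N d).
Local Notation alp := (alp s z N d).
Local Notation bet := (bet s z N d).
Let e2 := @eps_sq R s.
Let q2 := @level_sq R s.

Lemma lifted_sub (U U' : set V) : open U' -> U' `<=` U ->
  lifted_hypersurface s z N d U -> lifted_hypersurface s z N d U'.
Proof.
move=> oU' UU [oU d2 sz sN h1 h2 h3 h4 h5 h6]; split=> //.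
- exact: smooth_sub sz.
- exact: smooth_sub sN.
- by move=> u /UU; exact: h1.
- by move=> u /UU; exact: h2.
- by move=> u /UU; exact: h3.
- by move=> u /UU; exact: h4.
- by move=> X u /UU; exact: h5.
- by move=> u v /UU; exact: h6.
Qed.

Lemma alp_surj (U : set V) (H : lifted_hypersurface s z N d U) u (Uu : U u) v :
  horth s (z u) (N u) v -> exists X, alp X u = v.
Proof.
move=> ov; have o := horth_rev ov; have ff := frame_forms H Uu.
have [v1 [v2 [v3 v4]]] := ov; have d2 := lift_sign H.
have [X XE] := lift_full H Uu v1 v2 v3.
exists X.
have aux (D : E) (t h : R) : D + - t *: J (z u) = v ->
    << D, J (N u) >> = - d * h -> h = 0.
  move=> DE Dh; have : << D + - t *: J (z u), J (N u) >> = 0 by rewrite DE o.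
  rewrite formDl formZl formJJ ff Dh => /eqP.
  rewrite !mulr0 addr0 mulf_eq0 oppr_eq0 => /orP[d0|/eqP //].
  by rewrite (negPf (unit_neq0 d2)) in d0.
by rewrite alpE XE (aux _ _ _ XE (dz_JN H u X)) mulr0 scale0r addr0.
Qed.

Variable a : V -> R.

(** If eta is closed and dsig = dtau, the structure equations make the shape operator
    of H symmetric, anticommuting with J and of constant square. It is then
    parallel, and its curvature identity forces H = 0. But H has real dimension
    2n - 2 > 0. *)
Lemma no_flat_Hopf (U : set V) : (2 <= n)%N ->
  lifted_hypersurface s z N d U ->
  (forall u, U u -> exists xi, Hopf_vector s z N d u xi (a u)) ->
  (forall u X Y, U u -> 'D_X (eta Y) u - 'D_Y (eta X) u = 0) ->
  (forall u X Y, U u -> 'D_X (sig Y) u - 'D_Y (sig X) u =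
    'D_X (tau Y) u - 'D_Y (tau X) u) ->
  forall u, ~ U u.
Proof.
move=> n2 H hopf deta0 dsigtau u Uu.
have d2 := lift_sign H; have oU := lift_open H.
have ff y (Uy : U y) := frame_forms H Uy.
have oa y (Uy : U y) X := orth_alp H Uy X.
have ob y (Uy : U y) X := orth_bet H Uy X.
have surj y (Uy : U y) := alp_surj H Uy.
have ab y (Uy : U y) X Y : << alp X y, bet Y y >> = << alp Y y, bet X y >>.
  by have [xi hx] := hopf y Uy; exact: (bet_symmetric H _ _ Uy hx).
have aJb y (Uy : U y) X Y : << alp X y, J (bet Y y) >> = << alp Y y, J (bet X y) >>.
  have alg (x x' : R) : 0 = d * (x - x') -> x = x'.
    move=> /(congr1 (fun k => d * k)); rewrite mulr0 mulrA d2 mul1r => /esym/eqP.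
    by rewrite subr_eq0 => /eqP.
  apply: alg; apply: etrans (esym (deta0 y X Y Uy)) _; exact: (d_eta H Uy).
have bJb y (Uy : U y) X Y :
    << bet X y, J (bet Y y) >> = q * d * << alp X y, J (alp Y y) >>.
  have alg (x x' : R) : - 2 * (e * d) * x = - 2 * (e * q) * x' -> x = q * d * x'.
    move=> /(congr1 (fun k => - (e * d * k) / 2)) E1.
    have {E1} : (e * e) * (d * d) * x = (e * e) * (q * d) * x' by move: E1; lra.
    by rewrite d2 e2 !mul1r.
  apply: alg.
  exact: etrans (esym (d_sig H Uy X Y)) (etrans (dsigtau y X Y Uy) (d_tau H Uy X Y)).
have dt y (Uy : U y) X Y := d_tau H Uy X Y.
have ds y (Uy : U y) X Y := etrans (dsigtau y X Y Uy) (d_tau H Uy X Y).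
have dz X y (Uy : U y) := dzE s z N d y X.
have dN X y (Uy : U y) := dNE' s z N d y X.
have curv := shape_curvature oU d2 (lift_smooth H) (lift_smoothN H)
  (smooth_tau H) (smooth_sig H) (smooth_eta H) (smooth_alp H) (smooth_bet H)
  ff dz dN oa ob surj ab aJb bJb dt ds Uu.
have [v v0 [v1 v2 v3 v4]] := exists_orthogonal s n2 (z u) (J (z u)) (N u) (J (N u)).
have ov : horth s (z u) (N u) v by [].
move: v0; rewrite (horth_eq0 d2 (ff u Uu) (oa u Uu) (ob u Uu) (surj u Uu) (ab u Uu)
  (aJb u Uu) (bJb u Uu) curv ov).
by rewrite eqxx.
Qed.

End HopfFrame.

Section HopfCurvature.
Context {R : realType} {V : normedModType R} {n : nat} (s : space_form).
Local Notation E := ('rV[R]_n.+1 * 'rV[R]_n.+1)%type.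
Local Notation "<< x , y >>" := (@ambient_form R n s x y).
Local Notation J := (@Jmul R n s).
Local Notation e := (@eps R s).
Local Notation q := (@quadric_level R s).
Variables (z N : V -> E) (d : R) (U : set V) (a : V -> R) (X0 : V).
Local Notation tau := (tau s z).
Local Notation sig := (sig s N d).
Local Notation eta := (eta s z N d).
Local Notation alp := (alp s z N d).
Local Notation bet := (bet s z N d).
Hypothesis n2 : (2 <= n)%N.
Hypothesis H : lifted_hypersurface s z N d U.
Hypothesis hopf : forall u, U u -> exists xi, Hopf_vector s z N d u xi (a u).
Hypothesis eta_X0 : forall u, U u -> eta X0 u != 0.
Let e2 := @eps_sq R s.
Let oU := lift_open H.
Let stau := smooth_tau H.
Let ssig := smooth_sig H.
Let seta := smooth_eta H.

Local Ltac smooth := repeat (smooth_step; try exact: oU).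
Local Ltac diffble Uu := apply: (@smooth_differentiable _ _ U) Uu; smooth.

Lemma sig_tau X u : U u -> sig X u + - tau X u = e * (a u * eta X u).
Proof.
by move=> Uu; have [xi hx] := hopf Uu; rewrite mulrA; exact: (Hopf_sig H X Uu hx).
Qed.

Lemma smooth_Hopf_curvature : smooth_on U a.
Proof.
have st := stau X0; have ss := ssig X0; have se := seta X0.
have sV : smooth_on U (fun u => (eta X0 u)^-1) by apply: smooth_inv.
apply: (smooth_eq oU (f := fun u => e * (sig X0 u + - tau X0 u) * (eta X0 u)^-1)).
  move=> u Uu /=; rewrite (sig_tau X0 Uu); have := eta_X0 Uu.
  by move: (eta X0 u) => k k0; rewrite !mulrA e2 mul1r mulfK.
by smooth.
Qed.
Let sa := smooth_Hopf_curvature.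

Section AtPoint.
Variable u : V.
Hypothesis Uu : U u.

Lemma d_sig_tau X Y :
  ('D_X (sig Y) u - 'D_Y (sig X) u) - ('D_X (tau Y) u - 'D_Y (tau X) u) =
  e * ('D_X a u * eta Y u - 'D_Y a u * eta X u +
       a u * ('D_X (eta Y) u - 'D_Y (eta X) u)).
Proof.
have P A B : 'D_A (sig B) u - 'D_A (tau B) u =
    e * ('D_A a u * eta B u + a u * 'D_A (eta B) u).
  have st := stau B; have ss := ssig B; have se := seta B.
  rewrite -derive_mul; [|by diffble Uu..].
  rewrite -(@derive_mull _ _ e); last by diffble Uu.
  rewrite -(derive_eq_on oU A (fun y Uy => sig_tau B Uy) Uu).
  rewrite derive_add; [|by diffble Uu..].
  by rewrite derive_opp; last by diffble Uu.
have alg (s1 s2 t1 t2 a1 a2 h1 h2 k d1 d2 : R) :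
    s1 - t1 = e * (a1 * h2 + k * d1) -> s2 - t2 = e * (a2 * h1 + k * d2) ->
    (s1 - s2) - (t1 - t2) = e * (a1 * h2 - a2 * h1 + k * (d1 - d2)).
  move=> E1 E2; have -> : (s1 - s2) - (t1 - t2) = (s1 - t1) - (s2 - t2) by ring.
  by rewrite E1 E2; ring.
exact: alg (P X Y) (P Y X).
Qed.

(** The H-parts of dz and dN vanish at xi, so all structure equations do. *)
Lemma d_eta_Hopf xi c X : Hopf_vector s z N d u xi c ->
  'D_xi (eta X) u - 'D_X (eta xi) u = 0.
Proof.
move=> [a0 b0 _ _]; apply: etrans (d_eta H Uu xi X) _.
rewrite a0 b0; have -> : J 0 = 0 :> E by exact: linear0.
by rewrite form0l form0r subrr mulr0.
Qed.

(** Insert xi into d (sig - tau) = e d (a eta). *)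
Lemma derive_Hopf_curvature xi c X : Hopf_vector s z N d u xi c ->
  'D_X a u = 'D_xi a u * eta X u.
Proof.
move=> hx; have [a0 b0 h1 _] := hx.
have S : 'D_xi (sig X) u - 'D_X (sig xi) u = 0.
  by apply: etrans (d_sig H Uu xi X) _; rewrite b0 form0l mulr0.
have T : 'D_xi (tau X) u - 'D_X (tau xi) u = 0.
  by apply: etrans (d_tau H Uu xi X) _; rewrite a0 form0l mulr0.
have alg (dS dT dh ax ak hX hk k : R) : dS = 0 -> dT = 0 -> dh = 0 -> hk = 1 ->
    dS - dT = e * (ak * hX - ax * hk + k * dh) -> ax = ak * hX.
  move=> -> -> -> -> /(congr1 (fun k => e * k)).
  rewrite subr0 !mulr0 mulrA e2 mul1r addr0 mulr1 => /esym/eqP.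
  by rewrite subr_eq0 => /eqP.
exact: alg S T (d_eta_Hopf X hx) h1 (d_sig_tau xi X).
Qed.
End AtPoint.

Lemma derive_Hopf_curvature_eta u X Y : U u ->
  'D_Y a u * eta X u + - ('D_X a u * eta Y u) = 0.
Proof.
move=> Uu; have [xi hx] := hopf Uu.
have alg (ax ay k hX hY : R) : ax = k * hX -> ay = k * hY ->
    ay * hX + - (ax * hY) = 0 by move=> -> ->; ring.
exact: alg (derive_Hopf_curvature Uu X hx) (derive_Hopf_curvature Uu Y hx).
Qed.

(** The exterior derivative of da = (xi a) eta, wedged with eta; computed as the
    cyclic sum of the derivatives of [derive_Hopf_curvature_eta], where the second
    derivatives of a cancel. *)
Lemma derive_Hopf_curvature_d_eta u xi c X Y : U u ->
  Hopf_vector s z N d u xi c ->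
  'D_xi a u * ('D_X (eta Y) u - 'D_Y (eta X) u) = 0.
Proof.
move=> Uu hx.
have D A X' Y' : 'D_A (fun y => 'D_Y' a y) u * eta X' u + 'D_Y' a u * 'D_A (eta X') u
    - ('D_A (fun y => 'D_X' a y) u * eta Y' u + 'D_X' a u * 'D_A (eta Y') u) = 0.
  apply: etrans (derive_cst_on oU A
    (fun y Uy => derive_Hopf_curvature_eta X' Y' Uy) Uu).
  have dM P Q : differentiable (fun y => 'D_P a y * eta Q y) u.
    by have se := seta Q; diffble Uu.
  have M P Q : 'D_A (fun y => 'D_P a y * eta Q y) u =
      'D_A (fun y => 'D_P a y) u * eta Q u + 'D_P a u * 'D_A (eta Q) u.
    by have se := seta Q; apply: derive_mul; diffble Uu.
  have dMN P Q : differentiable (fun y => - ('D_P a y * eta Q y)) u.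
    by have se := seta Q; diffble Uu.
  apply/esym; apply: etrans (derive_add A (dM Y' X') (dMN X' Y')) _.
  exact: congr2 (M Y' X') (etrans (derive_opp A (dM X' Y')) (congr1 -%R (M X' Y'))).
have S A B := derive_symmetricR oU A B sa Uu.
have alg (sxy sxk sky syx skx syk hx' hy hk ax ay ak dkx dky dxy dxk dyk dyx : R) :
    skx = sxk -> sky = syk -> sxy = syx -> dkx - dxk = 0 -> dky - dyk = 0 ->
    sky * hx' + ay * dkx - (skx * hy + ax * dky) = 0 ->
    sxk * hy + ak * dxy - (sxy * hk + ay * dxk) = 0 ->
    syx * hk + ax * dyk - (syk * hx' + ak * dyx) = 0 ->
    ak * (dxy - dyx) = 0.
  move=> -> -> -> E1 E2 F1 F2 F3.
  have -> : ak * (dxy - dyx) =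
    (syk * hx' + ay * dkx - (sxk * hy + ax * dky)) +
    (sxk * hy + ak * dxy - (syx * hk + ay * dxk)) +
    (syx * hk + ax * dyk - (syk * hx' + ak * dyx))
    - ay * (dkx - dxk) + ax * (dky - dyk) by ring.
  by rewrite F1 F2 F3 E1 E2; ring.
exact: alg (S xi X) (S xi Y) (S X Y) (d_eta_Hopf Uu X hx) (d_eta_Hopf Uu Y hx)
  (D xi X Y) (D X Y xi) (D Y xi X).
Qed.

(** Where da does not vanish, eta is closed, and then d (a eta) = da /\ eta = 0, which
    [no_flat_Hopf] excludes. *)
Lemma Hopf_curvature_flat u X : U u -> 'D_X a u = 0.
Proof.
move=> Uu; apply/eqP/negPn/negP => Xu.
pose U' := U `&` [set y | 'D_X a y != 0].
have UU : U' `<=` U by move=> y [].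
have oU' : open U'.
  by apply: smooth_open_neq => //; exact: smooth_derive.
have xi0 y : U' y -> exists xi, Hopf_vector s z N d y xi (a y) /\ 'D_xi a y != 0.
  move=> [Uy /= ay]; have [xi hx] := hopf Uy; exists xi; split=> //.
  by apply: contraNneq ay => k0; rewrite (derive_Hopf_curvature Uy X hx) k0 mul0r.
have deta0 y A B : U' y -> 'D_A (eta B) y - 'D_B (eta A) y = 0.
  move=> Uy; have [xi [hx k0]] := xi0 y Uy.
  have := derive_Hopf_curvature_d_eta A B (UU _ Uy) hx => /eqP.
  by rewrite mulf_eq0 (negPf k0) => /eqP.
have hopf' y : U' y -> exists xi, Hopf_vector s z N d y xi (a y).
  by move=> /UU; exact: hopf.
apply: (no_flat_Hopf n2 (lifted_sub oU' UU H) hopf' deta0 _ (u := u)) => //.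
move=> y A B Uy; apply/eqP; rewrite -subr_eq0 (d_sig_tau (UU _ Uy)) deta0 //.
rewrite mulr0 addr0; have := derive_Hopf_curvature_eta B A (UU _ Uy).
by move=> E1; rewrite E1 mulr0.
Qed.

End HopfCurvature.

(** * The Levi-Civita connection of the quotient *)

Section Complement.
Context {R : realType} {n : nat} (s : space_form).
Local Notation E := ('rV[R]_n.+1 * 'rV[R]_n.+1)%type.
Local Notation "<< x , y >>" := (@ambient_form R n s x y).

(** Together with the linear map h, an orthogonal family b gives an injective map
    between spaces of the same dimension. *)
Lemma complement_surj k r (h : 'rV[R]_k -> E) (b : 'I_r -> E) :
  (k + r)%N = (n.+1 + n.+1)%N -> linear h -> (forall X, h X = 0 -> X = 0) ->
  (forall X i, << h X, b i >> = 0) -> (forall i, << b i, b i >> != 0) ->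
  (forall i j, i != j -> << b i, b j >> = 0) ->
  forall v, (forall i, << v, b i >> = 0) -> exists X, h X = v.
Proof.
move=> kr lh h0 hb bb bij v vb.
pose L (w : 'rV[R]_(k + r)) := h (lsubmx w) + \sum_i (rsubmx w) 0 i *: b i.
have Lb w i : << L w, b i >> = rsubmx w 0 i * << b i, b i >>.
  rewrite /L formDl hb add0r.
  have -> : << \sum_j rsubmx w 0 j *: b j, b i >> =
      \sum_j rsubmx w 0 j * << b j, b i >>.
    elim/big_ind2 : _ => [|x x' y y' <- <-|j _]; first exact: form0l.
      exact: formDl.
    exact: formZl.
  rewrite (bigD1 i) //= big1 ?addr0 // => j ji.
  by rewrite bij // mulr0.
have lL : linear L.
  move=> c x y; rewrite /L !linearP /= lh scalerDr scaler_sumr addrACA.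
  congr (_ + _); rewrite -big_split; apply: eq_bigr => i _ /=.
  by rewrite !mxE scalerDl scalerA.
have r0 w : (forall i, << L w, b i >> = 0) -> rsubmx w = 0.
  move=> Lw; apply/rowP => i; rewrite !mxE; apply/eqP.
  have := Lw i; rewrite Lb => /eqP; rewrite mulf_eq0 (negPf (bb i)) orbF.
  by rewrite mxE.
have L0 w : rsubmx w = 0 -> L w = h (lsubmx w).
  by move=> w0; rewrite /L w0 big1 ?addr0 // => i _; rewrite mxE scale0r.
have inj w : L w = 0 -> w = 0.
  move=> Lw; have w0 : rsubmx w = 0 by apply: r0 => i; rewrite Lw form0l.
  by rewrite -(hsubmxK w) w0 (h0 (lsubmx w)) ?row_mx0 // -L0.
have [w wE] := inj_surj lL kr inj v.
by exists (lsubmx w); rewrite -L0 //; apply: r0 => i; rewrite wE.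
Qed.
End Complement.

Section Param.
Context {R : realType} {n : nat} (s : space_form).
Local Notation E := ('rV[R]_n.+1 * 'rV[R]_n.+1)%type.
Local Notation "<< x , y >>" := (@ambient_form R n s x y).
Local Notation J := (@Jmul R n s).
Local Notation e := (@eps R s).
Local Notation q := (@quadric_level R s).
Local Notation W := 'rV[R]_(n.*2).
Let e2 := @eps_sq R s.
Let q2 := @level_sq R s.

Section HorizontalProjection.
Variable z : E.
Hypothesis zz : << z, z >> = q.

Lemma form_Jz_Jz : << J z, J z >> = e * q.
Proof. by rewrite formJJ zz. Qed.

Lemma hprojE v : hproj s z v =
  v - (q * << v, z >>) *: z - (e * q * << v, J z >>) *: J z.
Proof.
have eq2 : (e * q) * (e * q) = 1 by ring: e2 q2.
rewrite /hproj zz form_Jz_Jz (unit_inv q2) (unit_inv eq2).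
by rewrite [_ * q]mulrC [_ * (e * q)]mulrC.
Qed.

Lemma hproj_linear : linear (hproj s z).
Proof.
move=> a x y; apply: (@form_ext _ _ s) => w.
by rewrite !hprojE !(formDl, formNl, formZl); ring.
Qed.

Lemma hproj_z v : << hproj s z v, z >> = 0.
Proof.
have zJz := formxJ s z.
rewrite hprojE !formDl !formNl !formZl zz formJl zJz; ring: q2.
Qed.

Lemma hproj_Jz v : << hproj s z v, J z >> = 0.
Proof.
have zJz := formxJ s z.
rewrite hprojE !formDl !formNl !formZl form_Jz_Jz zJz; ring: e2 q2.
Qed.

Lemma hproj_id v : << v, z >> = 0 -> << v, J z >> = 0 -> hproj s z v = v.
Proof. by move=> v1 v2; rewrite hprojE v1 v2 !mulr0 !scale0r !subr0. Qed.

Lemma form_hproj v w : << w, z >> = 0 -> << w, J z >> = 0 ->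
  << hproj s z v, w >> = << v, w >>.
Proof.
move=> w1 w2; rewrite hprojE !formDl !formNl !formZl.
by rewrite [<< z, w >>]formC [<< J z, w >>]formC w1 w2; ring.
Qed.
End HorizontalProjection.

Section Parametrization.
Variables (sg : W -> E) (P : set W).
Hypothesis hP : is_param s sg P.

Let oP : open P. Proof. by case: hP. Qed.
Let ssg : smooth_on P sg. Proof. by case: hP. Qed.
Let lev p : P p -> << sg p, sg p >> = q. Proof. by case: hP => _ _ h _ _ /h. Qed.

Local Notation Pi w := (fun p => dproj s sg p w).
Local Notation tau := (tau s sg).

Lemma derive_level p w : P p -> << 'D_w sg p, sg p >> = 0.
Proof.
move=> Pp; have dsg := smooth_differentiable ssg Pp.
have := derive_cst_on oP w lev Pp.
rewrite derive_form // [<< sg p, _ >>]formC; lra.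
Qed.

Lemma dprojE p w : P p -> dproj s sg p w = 'D_w sg p + - tau w p *: J (sg p).
Proof.
move=> Pp; rewrite /dproj hprojE ?lev // derive_level //.
by rewrite mulr0 scale0r subr0 scaleNr.
Qed.

Lemma dproj_sg p w : P p -> << dproj s sg p w, sg p >> = 0.
Proof. by move=> Pp; apply: hproj_z; exact: lev. Qed.

Lemma dproj_Jsg p w : P p -> << dproj s sg p w, J (sg p) >> = 0.
Proof. by move=> Pp; apply: hproj_Jz; exact: lev. Qed.

Lemma dproj_linear p : P p -> linear (dproj s sg p).
Proof.
move=> Pp a v w; rewrite /dproj; have dsg := smooth_differentiable ssg Pp.
by rewrite !deriveE // linearP (hproj_linear (lev Pp)).
Qed.

Lemma dproj_sum p w : P p ->
  dproj s sg p w = \sum_j w 0 j *: dproj s sg p (delta_mx 0 j).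
Proof.
move=> Pp; pose L : {linear W -> E} := HB.pack (dproj s sg p)
  (GRing.isLinear.Build _ _ _ _ _ (dproj_linear Pp)).
rewrite {1}(row_sum_delta w) -[LHS]/(L _) linear_sum.
by apply: eq_bigr => j _; rewrite linearZ.
Qed.

Lemma smooth_tau_sg w : smooth_on P (tau w).
Proof.
suff : smooth_on P (fun p => e * q * << 'D_w sg p, J (sg p) >>) by [].
by repeat (smooth_step; try exact: oP).
Qed.

Lemma smooth_dproj w : smooth_on P (Pi w).
Proof.
have st := smooth_tau_sg w.
apply: (smooth_eq oP (f := fun p => 'D_w sg p + - tau w p *: J (sg p))).
  by move=> p Pp; rewrite dprojE.
by repeat (smooth_step; try exact: oP).
Qed.

Lemma dproj_surj p v : P p -> << v, sg p >> = 0 -> << v, J (sg p) >> = 0 ->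
  exists w, dproj s sg p w = v.
Proof.
move=> Pp v1 v2; have [_ _ _ _ inj] := hP.
have sJs := formxJ s (sg p).
pose b (i : 'I_2) : E := if i == 0 :> nat then sg p else J (sg p).
apply: (@complement_surj _ _ s _ _ (dproj s sg p) b).
- by rewrite addn2 addSn addnS addnn.
- exact: dproj_linear.
- by move=> X; exact: inj.
- by move=> X i; rewrite /b; case: ifP => _; rewrite ?dproj_sg ?dproj_Jsg.
- move=> i; rewrite /b; case: ifP => _.
    by rewrite lev //; exact: unit_neq0.
  by rewrite (form_Jz_Jz (lev Pp)) mulf_neq0 //; exact: unit_neq0.
- by move=> [[|[|//]] ?] [[|[|//]] ?] // _; rewrite /b /= ?formJl sJs ?oppr0.
- by move=> i; rewrite /b; case: ifP.
Qed.

Lemma horizontal_ext p v v' : P p ->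
  << v, sg p >> = 0 -> << v, J (sg p) >> = 0 ->
  << v', sg p >> = 0 -> << v', J (sg p) >> = 0 ->
  (forall j, << v, dproj s sg p (delta_mx 0 j) >> =
     << v', dproj s sg p (delta_mx 0 j) >>) -> v = v'.
Proof.
move=> Pp v1 v2 w1 w2 E1; apply: (@form_ext _ _ s) => y.
have zz := lev Pp.
have [w wE] := dproj_surj Pp (hproj_z zz y) (hproj_Jz zz y).
rewrite [LHS]formC [RHS]formC -(form_hproj zz y v1 v2) -(form_hproj zz y w1 w2).
rewrite -wE dproj_sum //.
elim/big_ind : _ => [|x x' Ex Ex'|j _]; first by rewrite !form0l.
  by rewrite !formDl Ex Ex'.
by rewrite !formZl [<< _, v >>]formC E1 formC.
Qed.

Lemma metric_mxE p i j : metric_mx s sg p i j =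
  << dproj s sg p (delta_mx 0 i), dproj s sg p (delta_mx 0 j) >>.
Proof. by rewrite mxE. Qed.

Lemma metric_mx_unit p : P p -> metric_mx s sg p \in unitmx.
Proof.
move=> Pp; rewrite -row_free_unit; apply: inj_row_free => x xG.
have [_ _ _ _ inj] := hP; apply: (inj p) => //.
apply: (horizontal_ext Pp); rewrite ?dproj_sg ?dproj_Jsg ?form0l // => j.
rewrite form0l.
have := congr1 (fun M : 'rV_ _ => M 0 j) xG; rewrite !mxE => <-.
rewrite dproj_sum //.
transitivity (\sum_i << x 0 i *: dproj s sg p (delta_mx 0 i),
    dproj s sg p (delta_mx 0 j) >>).
  elim/big_ind2 : _ => [|x1 x' y1 y' <- <-|i _ //]; first exact: form0l.
  exact: formDl.
by apply: eq_bigr => i _; rewrite formZl metric_mxE.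
Qed.

(** O'Neill's description of the connection of the quotient: project the ambient
    derivative, and correct it by the rotation of the fibre along which v moves
    the point [sg p]. *)
Definition lc (v w p : W) : E :=
  hproj s (sg p) ('D_v (Pi w) p) + - tau v p *: J (dproj s sg p w).

Section AtPoint.
Variable p : W.
Hypothesis Pp : P p.
Let zz := lev Pp.
Local Notation D w := (dproj s sg p w).

Let dPi w : differentiable (Pi w) p.
Proof. exact: smooth_differentiable (smooth_dproj w) Pp. Qed.

Let JD_sg w : << J (D w), sg p >> = 0.
Proof. by rewrite formJl dproj_Jsg // oppr0. Qed.

Let JD_Jsg w : << J (D w), J (sg p) >> = 0.
Proof. by rewrite formJJ dproj_sg // mulr0. Qed.

Lemma lc_sg v w : << lc v w p, sg p >> = 0.
Proof. by rewrite /lc formDl formZl hproj_z // JD_sg mulr0 addr0. Qed.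

Lemma lc_Jsg v w : << lc v w p, J (sg p) >> = 0.
Proof. by rewrite /lc formDl formZl hproj_Jz // JD_Jsg mulr0 addr0. Qed.

Lemma form_lc v w y : << y, sg p >> = 0 -> << y, J (sg p) >> = 0 ->
  << lc v w p, y >> = << 'D_v (Pi w) p, y >> - tau v p * << J (D w), y >>.
Proof. by move=> y1 y2; rewrite /lc formDl formZl form_hproj // mulNr. Qed.

Lemma form_lcE a b y : << y, sg p >> = 0 -> << y, J (sg p) >> = 0 ->
  << lc a b p, y >> = << 'D_a (fun p => 'D_b sg p) p, y >>
    - tau b p * << J (D a), y >> - tau a p * << J (D b), y >>.
Proof.
move=> y1 y2; apply: etrans (form_lc a b y1 y2) _; congr (_ - _).
have st := smooth_tau_sg b.
rewrite (derive_eq_on oP a (fun p Pp => dprojE b Pp) Pp).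
rewrite derive_add; [|by apply: (@smooth_differentiable _ _ P) Pp;
  repeat (smooth_step; try exact: oP)..].
rewrite (@derive_scale _ _ E); [|by apply: (@smooth_differentiable _ _ P) Pp;
  repeat (smooth_step; try exact: oP)..].
rewrite derive_J; last exact: smooth_differentiable ssg Pp.
have aux (x x' x'' : E) (t t' : R) : x'' = x' + - t' *: J (sg p) ->
   << x + (t *: J (sg p) + - tau b p *: J x'), y >> =
   << x, y >> - tau b p * << J x'', y >>.
  move=> ->; have o1 := formC s (sg p) y; have o2 := formC s (J (sg p)) y.
  rewrite y1 in o1; rewrite y2 in o2.
  by rewrite !(JD, JZ, JJ, formDl, formZl) o1 o2; ring.
exact: aux (dprojE a Pp).
Qed.

Lemma lc_torsion_free v w : lc v w p = lc w v p.
Proof.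
apply: (horizontal_ext Pp);
  [exact: lc_sg|exact: lc_Jsg|exact: lc_sg|exact: lc_Jsg|] => j.
have y1 := dproj_sg 'e_j Pp; have y2 := dproj_Jsg 'e_j Pp.
have S := congr1 (fun x => << x, D 'e_j >>) (derive_symmetric s oP v w ssg Pp).
have alg (x x' d d' t t' : R) : d = d' -> x = d - t - t' -> x' = d' - t' - t ->
  x = x' by move=> -> -> ->; ring.
exact: alg S (form_lcE v w y1 y2) (form_lcE w v y1 y2).
Qed.

Lemma lc_metric u v w :
  'D_u (fun p => << Pi v p, Pi w p >>) p = << lc u v p, D w >> + << D v, lc u w p >>.
Proof.
have F1 := form_lc u v (dproj_sg w Pp) (dproj_Jsg w Pp).
have F2 := form_lc u w (dproj_sg v Pp) (dproj_Jsg v Pp).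
have skew := formJ_skew s (D w) (D v).
have alg (x a b c l1 l2 l2' t k k' : R) : x = a + b -> b = c -> l2' = l2 ->
    l1 = a - t * k -> l2 = c - t * k' -> k' = - k -> x = l1 + l2'.
  by move=> -> -> -> -> -> ->; ring.
exact: alg (derive_form s u (dPi v) (dPi w)) (formC s _ _) (formC s _ _) F1 F2 skew.
Qed.

(** Koszul formula: [lc] is metric and free of torsion. *)
Lemma christoffelE (k i j : 'I_(n.*2)) :
  christoffel (metric_mx s sg) p k i j =
  \sum_l invmx (metric_mx s sg p) k l * << lc 'e_i 'e_j p, D 'e_l >>.
Proof.
have Dg a b c : 'D_'e_a (fun x => metric_mx s sg x b c) p =
    << lc 'e_a 'e_b p, D 'e_c >> + << D 'e_b, lc 'e_a 'e_c p >>.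
  have -> : (fun x => metric_mx s sg x b c) =
      (fun x => << dproj s sg x 'e_b, dproj s sg x 'e_c >>).
    by apply/funext => x; exact: metric_mxE.
  exact: lc_metric.
rewrite /christoffel mulr_sumr; apply: eq_bigr => l _.
have T1 := congr1 (fun x => << x, D 'e_l >>) (lc_torsion_free 'e_j 'e_i).
have T2 := etrans (congr1 (fun x => << x, D 'e_j >>) (lc_torsion_free 'e_l 'e_i))
  (formC s _ _).
have T3 := congr1 (fun x => << D 'e_i, x >>) (lc_torsion_free 'e_l 'e_j).
have alg (g d1 d2 d3 a b a' c b' c' : R) : a' = a -> b' = b -> c' = c ->
    d1 = a + b -> d2 = a' + c -> d3 = b' + c' ->
    2^-1 * (g * (d1 + d2 - d3)) = g * a.
  by move=> -> -> -> -> -> ->; field.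
exact: alg T1 T2 T3 (Dg i j l) (Dg j i l) (Dg l i j).
Qed.

Lemma lc_linearl w : linear (fun v => lc v w p).
Proof.
move=> a u v; have dsg := smooth_differentiable ssg Pp.
have tl : tau (a *: u + v) p = a * tau u p + tau v p.
  have alg (x y c : E) :
      e * q * << a *: x + y, c >> = a * (e * q * << x, c >>) + e * q * << y, c >>.
    by rewrite formDl formZl; ring.
  apply: etrans (congr1 (fun x => e * q * << x, J (sg p) >>)
    (derive_linear a u v dsg)) _; exact: alg.
have alg (d x y c : E) (t t1 t2 : R) : d = a *: x + y -> t = a * t1 + t2 ->
    hproj s (sg p) d + - t *: c =
    a *: (hproj s (sg p) x + - t1 *: c) + (hproj s (sg p) y + - t2 *: c).
  move=> -> ->; rewrite (hproj_linear zz); apply: (@form_ext _ _ s) => w'.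
  by rewrite !(formDl, formZl); ring.
exact: alg (derive_linear a u v (dPi w)) tl.
Qed.

Lemma lc_suml v w : lc v w p = \sum_i v 0 i *: lc 'e_i w p.
Proof.
pose L : {linear W -> E} := HB.pack (fun v => lc v w p)
  (GRing.isLinear.Build _ _ _ _ _ (lc_linearl w)).
rewrite {1}(row_sum_delta v) -[LHS]/(L _) linear_sum.
by apply: eq_bigr => j _; rewrite linearZ.
Qed.

Lemma dproj_christoffel (i j : 'I_(n.*2)) :
  D (\row_k christoffel (metric_mx s sg) p k i j) = lc 'e_i 'e_j p.
Proof.
apply: (horizontal_ext Pp); rewrite ?lc_sg ?lc_Jsg ?dproj_sg ?dproj_Jsg // => m.
rewrite dproj_sum //.
transitivity (\sum_k << christoffel (metric_mx s sg) p k i j *: D 'e_k, D 'e_m >>).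
  elim/big_ind2 : _ => [|x1 x' y1 y' <- <-|k _]; first exact: form0l.
    exact: formDl.
  by rewrite mxE.
under eq_bigr => k _ do rewrite formZl -metric_mxE christoffelE mulr_suml.
rewrite exchange_big /=.
transitivity (\sum_l (l == m)%:R * << lc 'e_i 'e_j p, D 'e_l >>).
  apply: eq_bigr => l _.
  have GG : metric_mx s sg p *m invmx (metric_mx s sg p) = 1%:M.
    by rewrite mulmxV // metric_mx_unit.
  have := congr1 (fun M : 'M[R]_(n.*2) => M m l) GG; rewrite !mxE eq_sym => <-.
  rewrite mulr_suml; apply: eq_bigr => k _.
  have Gsym : metric_mx s sg p k m = metric_mx s sg p m k.
    exact: etrans (metric_mxE p k m) (etrans (formC s _ _) (esym (metric_mxE p m k))).
  have alg (g a b c : R) : b = c -> g * a * b = c * g * a by move=> ->; ring.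
  exact: alg Gsym.
rewrite (bigD1 m) //= eqxx mul1r big1 ?addr0 // => l lm.
by rewrite (negPf lm) mul0r.
Qed.

Lemma dproj_christoffel_form v w :
  D (christoffel_form (metric_mx s sg) p v w) = lc v w p.
Proof.
pose L : {linear W -> E} := HB.pack (dproj s sg p)
  (GRing.isLinear.Build _ _ _ _ _ (dproj_linear Pp)).
have -> : christoffel_form (metric_mx s sg) p v w =
    \sum_i \sum_j (v 0 i * w 0 j) *: \row_k christoffel (metric_mx s sg) p k i j.
  apply/rowP => k; rewrite mxE summxE; apply: eq_bigr => i _.
  rewrite summxE; apply: eq_bigr => j _; rewrite !mxE; ring.
rewrite -[LHS]/(L _) linear_sum lc_suml; apply: eq_bigr => i _.
rewrite linear_sum lc_torsion_free lc_suml scaler_sumr; apply: eq_bigr => j _.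
by rewrite linearZ /= dproj_christoffel scalerA lc_torsion_free.
Qed.

End AtPoint.
End Parametrization.
End Param.

(** * Lifting a hypersurface to the quadric *)

Section Lift.
Context {R : realType} {n : nat} (s : space_form).
Local Notation E := ('rV[R]_n.+1 * 'rV[R]_n.+1)%type.
Local Notation "<< x , y >>" := (@ambient_form R n s x y).
Local Notation J := (@Jmul R n s).
Local Notation e := (@eps R s).
Local Notation q := (@quadric_level R s).
Local Notation W := 'rV[R]_(n.*2).
Variables (sg : W -> E) (P : set W).
Hypothesis hP : is_param s sg P.
Variables (m : nat) (U : set 'rV[R]_m) (y nu : 'rV[R]_m -> W).
Hypotheses (oU : open U) (sy : smooth_on U y) (snu : smooth_on U nu).
Hypothesis yUP : y @` U `<=` P.

Definition lift_pos u := sg (y u).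
Definition lift_nor u := dproj s sg (y u) (nu u).
Local Notation z := lift_pos.
Local Notation N := lift_nor.

Let yP u : U u -> P (y u). Proof. by move=> Uu; apply: yUP; exists u. Qed.
Let ssg : smooth_on P sg. Proof. by case: hP. Qed.
Let lev p : P p -> << sg p, sg p >> = q. Proof. by case: hP => _ _ h _ _ /h. Qed.

Lemma smooth_lift_pos : smooth_on U z.
Proof. exact: smooth_comp oU yUP ssg sy. Qed.

Let coef j u := nu u 0 j.
Let scoef j : smooth_on U (coef j).
Proof.
by move=> k; exact: (Ck_on_lin (@coord_linear _ _ _ 0 j) (@coord_cont _ _ _ 0 j) oU (snu k)).
Qed.

Let basis j u := dproj s sg (y u) (delta_mx 0 j).
Let sbasis j : smooth_on U (basis j).
Proof. exact: smooth_comp oU yUP (smooth_dproj hP (delta_mx 0 j)) sy. Qed.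

Lemma smooth_lift_nor : smooth_on U N.
Proof.
apply: (smooth_eq oU (f := fun u => \sum_j coef j u *: basis j u)).
  by move=> u Uu; rewrite /N (dproj_sum hP _ (yP Uu)).
by move=> k; apply: Ck_on_sum => // j; exact: (smooth_scale oU (scoef j) (sbasis j)).
Qed.

Section AtPoint.
Variables (u X : 'rV[R]_m).
Hypothesis Uu : U u.
Let dy : differentiable y u. Proof. exact: smooth_differentiable sy Uu. Qed.
Let dnu : differentiable nu u. Proof. exact: smooth_differentiable snu Uu. Qed.

Lemma derive_lift_pos : 'D_X z u = 'D_('D_X y u) sg (y u).
Proof. by apply: derive_comp => //; exact: smooth_differentiable ssg (yP Uu). Qed.

Lemma tau_lift_pos : tau s z X u = tau s sg ('D_X y u) (y u).
Proof.
have E1 := congr1 (fun x => e * q * << x, J (sg (y u)) >>) derive_lift_pos.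
exact: E1.
Qed.

Lemma horizontal_derive_lift_pos :
  'D_X z u + - tau s z X u *: J (z u) = dproj s sg (y u) ('D_X y u).
Proof.
by rewrite derive_lift_pos tau_lift_pos (dprojE hP _ (yP Uu)).
Qed.

Lemma derive_coef j : 'D_X (coef j) u = 'D_X nu u 0 j.
Proof. exact: (derive_lin (@coord_linear _ _ _ 0 j) (@coord_cont _ _ _ 0 j)). Qed.

Lemma derive_lift_nor : 'D_X N u = dproj s sg (y u) ('D_X nu u) +
  'D_('D_X y u) (fun p => dproj s sg p (nu u)) (y u).
Proof.
have NE t : U t -> N t = \sum_j coef j t *: basis j t.
  by move=> Ut; rewrite /N (dproj_sum hP _ (yP Ut)).
have PE p : P p -> dproj s sg p (nu u) =
    \sum_j coef j u *: dproj s sg p (delta_mx 0 j).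
  by move=> Pp; rewrite (dproj_sum hP _ Pp).
have oP : open P by case: hP.
have dc j := smooth_differentiable (scoef j) Uu.
have db j := smooth_differentiable (sbasis j) Uu.
have dp j := smooth_differentiable (smooth_dproj hP (delta_mx 0 j)) (yP Uu).
have dsum j : differentiable (fun t => coef j t *: basis j t) u.
  exact: smooth_differentiable (smooth_scale oU (scoef j) (sbasis j)) Uu.
have dbasis j : 'D_X (basis j) u =
    'D_('D_X y u) (fun p => dproj s sg p (delta_mx 0 j)) (y u).
  by apply: derive_comp.
have E1 : 'D_X N u = \sum_j ('D_X nu u 0 j *: basis j u +
    coef j u *: 'D_('D_X y u) (fun p => dproj s sg p (delta_mx 0 j)) (y u)).
  have F1 : 'D_X N u = 'D_X (fun t => \sum_j coef j t *: basis j t) u.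
    by have := derive_eq_on oU X NE Uu; apply.
  have F2 : 'D_X (fun t => \sum_j coef j t *: basis j t) u =
      \sum_j 'D_X (fun t => coef j t *: basis j t) u.
    by have := derive_bigsum X dsum; apply.
  rewrite F1 F2; apply: eq_bigr => j _.
  have F3 : 'D_X (fun t => coef j t *: basis j t) u =
      'D_X (coef j) u *: basis j u + coef j u *: 'D_X (basis j) u.
    by have := derive_scale X (dc j) (db j); apply.
  have alg (c c' k : R) (b x x' : E) : c = c' -> x = x' ->
    c *: b + k *: x = c' *: b + k *: x' by move=> -> ->.
  apply: etrans F3 _; exact: alg (derive_coef j) (dbasis j).
have dcp j : differentiable
    (fun p => coef j u *: dproj s sg p (delta_mx 0 j)) (y u).
  exact: differentiableZ (dp j).
have E2 : 'D_('D_X y u) (fun p => dproj s sg p (nu u)) (y u) =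
    \sum_j coef j u *: 'D_('D_X y u) (fun p => dproj s sg p (delta_mx 0 j)) (y u).
  have F1 : 'D_('D_X y u) (fun p => dproj s sg p (nu u)) (y u) =
      'D_('D_X y u)
        (fun p => \sum_j coef j u *: dproj s sg p (delta_mx 0 j)) (y u).
    by have := derive_eq_on oP ('D_X y u) PE (yP Uu); apply.
  have F2 : 'D_('D_X y u)
        (fun p => \sum_j coef j u *: dproj s sg p (delta_mx 0 j)) (y u) =
      \sum_j 'D_('D_X y u)
        (fun p => coef j u *: dproj s sg p (delta_mx 0 j)) (y u).
    by have := derive_bigsum ('D_X y u) dcp; apply.
  apply: etrans F1 _; apply: etrans F2 _; apply: eq_bigr => j _.
  by have := derive_scalel (coef j u) ('D_X y u) (dp j); apply.
have E3 := dproj_sum hP ('D_X nu u) (yP Uu).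
have alg (x d b : E) (c d' : 'I_(n.*2) -> E) : x = \sum_j (c j + d' j) ->
    b = \sum_j d' j -> d = \sum_j c j -> x = d + b.
  by move=> -> -> ->; rewrite big_split.
exact: alg E1 E2 E3.
Qed.

(** D N differs from the lift of the derivative of nu because z may also move along
    the fibre: at speed tau this rotates the lifted vectors by tau J. *)
Lemma dproj_covD :
  dproj s sg (y u) (covD (metric_mx s sg) y nu u X) =
  hproj s (z u) ('D_X N u) + - tau s z X u *: J (N u).
Proof.
rewrite /covD -[X in X + _]scale1r (dproj_linear hP (yP Uu)) scale1r.
rewrite (dproj_christoffel_form hP (yP Uu)) /lc derive_lift_nor tau_lift_pos.
rewrite -[X in hproj _ _ (X + _)]scale1r (hproj_linear (lev (yP Uu))) scale1r.
rewrite (hproj_id (lev (yP Uu)) (dproj_sg hP _ (yP Uu)) (dproj_Jsg hP _ (yP Uu))).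
exact: addrA.
Qed.
End AtPoint.
End Lift.

(** * Constancy of the Hopf principal curvature *)

Section HopfHypersurface.
Context {R : realType} {n : nat} (s : space_form) {S : topologicalType}.
Local Notation E := ('rV[R]_n.+1 * 'rV[R]_n.+1)%type.
Local Notation "<< x , y >>" := (@ambient_form R n s x y).
Local Notation J := (@Jmul R n s).
Local Notation e := (@eps R s).
Local Notation q := (@quadric_level R s).
Hypothesis n2 : (2 <= n)%N.
Variable h : hypersurface R n s S.
Variables (a : S -> R) (a_def : forall x, xi_curvature h x (a x)).
Let e2 := @eps_sq R s.
Let q2 := @level_sq R s.

Section InCoordinates.
Variable k : @coords R n S.
Hypothesis hk : hs_coords h k.
Local Notation m := (n.*2.-1).
Local Notation U := (udom k).
Local Notation sg := (par k).
Local Notation y := (pos k).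
Local Notation nu := (nor k).
Local Notation z := (lift_pos sg y).
Local Notation N := (lift_nor s sg y nu).

Let hP : is_param s sg (pdom k). Proof. by case: hk => -[]. Qed.
Let oU : open U. Proof. by case: hk => _ []. Qed.
Let sy : smooth_on U y. Proof. by case: hk => _ _ []. Qed.
Let yUP : y @` U `<=` pdom k. Proof. by case: hk => _ _ []. Qed.
Let snu : smooth_on U nu. Proof. by case: hk. Qed.
Let yP u : U u -> pdom k (y u). Proof. by move=> Uu; apply: yUP; exists u. Qed.
Let lev u : U u -> << z u, z u >> = q.
Proof. by move=> /yP; case: hP => _ _ + _ _ => /[apply]. Qed.

Lemma lift_nor_z u : U u -> << N u, z u >> = 0.
Proof. by move=> /yP; exact: dproj_sg. Qed.

Lemma lift_nor_Jz u : U u -> << N u, J (z u) >> = 0.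
Proof. by move=> /yP; exact: dproj_Jsg. Qed.

Lemma lift_nor_unit u : U u -> << N u, N u >> = 1 \/ << N u, N u >> = -1.
Proof. exact: hs_unit hk. Qed.

Lemma derive_lift_pos_nor X u : U u -> << 'D_X z u, N u >> = 0.
Proof.
move=> Uu; have E1 := horizontal_derive_lift_pos hP sy yUP X Uu.
have h0 : << dproj s sg (y u) ('D_X y u), N u >> = 0 := hs_normal X hk Uu.
have alg (x c : E) t : x + - t *: J (z u) = c -> << c, N u >> = 0 ->
    << x, N u >> = 0.
  have Jz : << J (z u), N u >> = 0 := etrans (formC s _ _) (lift_nor_Jz Uu).
  by move=> <-; rewrite formDl formZl Jz mulr0 addr0.
exact: alg E1 h0.
Qed.

Lemma lift_is_full u d v : U u -> << N u, N u >> = d -> d != 0 ->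
  << v, z u >> = 0 -> << v, J (z u) >> = 0 -> << v, N u >> = 0 ->
  exists X, 'D_X z u + - tau s z X u *: J (z u) = v.
Proof.
move=> Uu Nd d0 v1 v2 v3.
have hz X := horizontal_derive_lift_pos hP sy yUP X Uu.
have dy := smooth_differentiable sy Uu.
pose hor X := dproj s sg (y u) ('D_X y u).
suff [X XE] : exists X, hor X = v by exists X; rewrite hz.
have Nz := lift_nor_z Uu; have NJz := lift_nor_Jz Uu.
have zJz := formxJ s (z u).
pose b (i : 'I_3) : E := nth 0 [:: z u; J (z u); N u] i.
apply: (@complement_surj _ _ s _ _ hor b).
- by rewrite addn3 prednK ?double_gt0 ?(ltnW n2) // addSn addnS addnn.
- move=> c X Y; rewrite /hor derive_linear //; exact: dproj_linear (yP Uu) _ _ _.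
- move=> X hX; apply: (hs_immersion hk Uu).
  by case: hP => _ _ _ _ inj; exact: inj (yP Uu) hX.
- move=> X [[|[|[|//]]] i3]; rewrite /b /=.
  + exact: dproj_sg (yP Uu).
  + exact: dproj_Jsg (yP Uu).
  + exact: hs_normal hk Uu.
- move=> [[|[|[|//]]] i3]; rewrite /b /=.
  + by rewrite lev //; exact: unit_neq0.
  + by rewrite formJJ lev // mulf_neq0 //; exact: unit_neq0.
  + by rewrite Nd.
- move=> [[|[|[|//]]] i3] [[|[|[|//]]] j3] //= _; rewrite /b /=.
  + by rewrite formC.
  + by rewrite formJl zJz oppr0.
  + by rewrite formC.
- by move=> [[|[|[|//]]] i3]; rewrite /b.
Qed.

Let sz : smooth_on U z := smooth_lift_pos hP oU sy yUP.
Let sN : smooth_on U N := smooth_lift_nor hP oU sy snu yUP.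

Lemma lifted_of_coords d (U' : set 'rV[R]_m) : open U' -> U' `<=` U ->
  d * d = 1 -> (forall u, U' u -> << N u, N u >> = d) ->
  lifted_hypersurface s z N d U'.
Proof.
move=> oU' UU d2 Nd; split=> //.
- exact: smooth_sub sz.
- exact: smooth_sub sN.
- by move=> u /UU; exact: lev.
- by move=> u /UU; exact: lift_nor_z.
- by move=> u /UU; exact: lift_nor_Jz.
- by move=> X u /UU; exact: derive_lift_pos_nor.
- move=> u v Uu; apply: (lift_is_full (UU u Uu) (Nd u Uu)).
  exact: unit_neq0.
Qed.

Lemma Hopf_vector_of_coords d (U' : set 'rV[R]_m) u X c :
  lifted_hypersurface s z N d U' -> U' `<=` U -> U' u ->
  is_structure_vector s k u X -> is_shape s k u X (c *: X) ->
  Hopf_vector s z N d u X c.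
Proof.
move=> HL UU Uu' strX shapeX; have Uu := UU u Uu'; have d2 := lift_sign HL.
have Nd := lift_unit HL Uu'.
have hz := horizontal_derive_lift_pos hP sy yUP X Uu.
have zz := lev Uu; have zJz := formxJ s (z u).
have Nz := lift_nor_z Uu; have NJz := lift_nor_Jz Uu.
have zJN : << z u, J (N u) >> = 0 by rewrite form_Jskew NJz oppr0.
have zN : << z u, N u >> = 0 := etrans (formC s _ _) Nz.
have str : 'D_X z u + - tau s z X u *: J (z u) = - e *: J (N u).
  exact: etrans hz strX.
have JNz : << J (N u), z u >> = 0 := etrans (formC s _ _) zJN.
have JNJz : << J (N u), J (z u) >> = 0 by rewrite formJJ Nz mulr0.
have JzJN : << J (z u), J (N u) >> = 0 := etrans (formC s _ _) JNJz.
have JNJN : << J (N u), J (N u) >> = e * d by rewrite formJJ Nd.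
have eta1 : eta s z N d X u = 1.
  have alg (D : E) t : D + - t *: J (z u) = - e *: J (N u) ->
      - d * << D, J (N u) >> = 1.
    move=> DE; have : << D + - t *: J (z u), J (N u) >> = - e * (e * d).
      by rewrite DE formZl JNJN.
    rewrite formDl formZl JzJN mulr0 addr0 => ->; ring: e2 d2.
  exact: alg str.
have cov : hproj s (z u) ('D_X N u) = (tau s z X u + e * c) *: J (N u).
  have C1 := dproj_covD hP oU sy snu yUP X Uu.
  have C2 : dproj s sg (y u) (covD (metric_mx s sg) y nu u X) =
      (c * e) *: J (N u).
    have -> : covD (metric_mx s sg) y nu u X = - (c *: 'D_X y u).
      apply: etrans shapeX _; congr (- _).
      have := derive_linear c X 0 (smooth_differentiable sy Uu).
      by rewrite addr0 derive0 addr0.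
    have lin := dproj_linear hP (yP Uu).
    have := lin (- c) ('D_X y u) 0; rewrite scaleNr addr0 => ->.
    have -> : dproj s sg (y u) 0 = 0.
      by have := lin (-1) 0 0; rewrite scaler0 addr0 scaleN1r addNr.
    rewrite addr0 -hz str scalerA mulrNN //.
  have alg (x : E) (t : R) : (c * e) *: J (N u) = x + - t *: J (N u) ->
      x = (t + e * c) *: J (N u).
    move=> E1; apply: (@form_ext _ _ s) => w.
    have := congr1 (fun v => << v, w >>) E1; rewrite !(formDl, formZl); lra.
  exact: alg (etrans (esym C2) C1).
have sigE : sig s N d X u = tau s z X u + e * c.
  have alg (D : E) t : hproj s (z u) D = t *: J (N u) ->
      e * d * << D, J (N u) >> = t.
    move=> DE; rewrite -(form_hproj zz D JNz JNJz) DE formZl JNJN; ring: e2 d2.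
  exact: alg cov.
split=> //.
- by rewrite alpE str eta1 mulr1 -scalerDl addNr scale0r.
- have [b1 [b2 _]] := orth_bet HL Uu' X.
  rewrite -(hproj_id zz b1 b2) betE eta1 sigE.
  have alg (D : E) (t l : R) : hproj s (z u) D = t *: J (N u) ->
      hproj s (z u) (D + - t *: J (N u) + l *: J (z u)) = 0.
    move=> DE; apply: (@form_ext _ _ s) => w.
    have := congr1 (fun v => << v, w >>) DE; rewrite !(hprojE zz).
    rewrite !(formDl, formNl, formZl) form0l JNz JNJz (form_Jz_Jz zz).
    rewrite [<< J (z u), z u >>]formC zJz => E1.
    have {}E1 : << D, w >> - q * << D, z u >> * << z u, w >> -
      e * q * << D, J (z u) >> * << J (z u), w >> - t * << J (N u), w >> = 0.
      by rewrite E1 subrr.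
    by apply: etrans _ E1; ring: e2 q2.
  exact: alg cov.
- by rewrite sigE; ring.
Qed.

(** The neighbourhood is cut down so that < N, N > has constant sign and one fixed
    coordinate direction X0 stays transverse to the kernel of eta, which makes the
    principal curvature a smooth quotient. *)
Lemma Hopf_curvature_locally_constant u0 : U u0 ->
  \forall u \near u0, a (cinv (src k) u) = a (cinv (src k) u0).
Proof.
move=> Uu0; pose d := << N u0, N u0 >>; pose f u := a (cinv (src k) u).
have d2 : d * d = 1.
  by rewrite /d; case: (lift_nor_unit Uu0) => ->; rewrite ?mulrNN mulr1.
pose U1 := U `&` [set u | << N u, N u >> != - d].
have oU1 : open U1.
  have sNN : smooth_on U (fun u => << N u, N u >>) by exact: smooth_form.
  exact: (@smooth_open_neq _ _ U oU (fun u => << N u, N u >>) (- d) sNN).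
have N1 u : U1 u -> << N u, N u >> = d.
  move=> [Uu /= Nu]; move: Nu; rewrite /d.
  case: (lift_nor_unit Uu) => ->; case: (lift_nor_unit Uu0) => ->;
    by rewrite ?opprK ?eqxx.
have U10 : U1 u0.
  split=> //=; rewrite -/d -subr_eq0 opprK -mulr2n mulrn_eq0 /=.
  exact: unit_neq0.
have H1 := lifted_of_coords oU1 (fun u Uu => Uu.1) d2 N1.
have xi u : U1 u -> exists X, Hopf_vector s z N d u X (f u).
  move=> U1u; have [Uu _] := U1u.
  have [Ak _] := hk; case: (hk) => _ [_ Udom] _ _ _.
  have [x xd xu] := Udom u Uu.
  have chx : cinv (src k) u = x.
    have [[As _] _ _ _ _] := hk; have [cA _ _] := hs_atlas h.
    by have [_ _ K _ _] := cA _ As; rewrite -xu K.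
  have kx : coords_at k x by split=> //; rewrite xu.
  have [X sX shX] := a_def hk kx; rewrite xu in sX shX.
  exists X; rewrite /f chx.
  exact: Hopf_vector_of_coords H1 (fun u Uu => Uu.1) U1u sX shX.
have [X0 [_ _ eta0 _]] := xi u0 U10.
pose U2 := U1 `&` [set u | eta s z N d X0 u != 0].
have oU2 : open U2 by apply: smooth_open_neq => //; exact: smooth_eta H1 X0.
have U20 : U2 u0 by split=> //=; rewrite eta0 oner_neq0.
have H2 := lifted_sub oU2 (fun u Uu => Uu.1) H1.
have xi2 u : U2 u -> exists X, Hopf_vector s z N d u X (f u) by move=> [/xi].
have e0 u : U2 u -> eta s z N d X0 u != 0 by case.
have sf := smooth_Hopf_curvature H2 xi2 e0.
have df u X : U2 u -> 'D_X f u = 0 := @Hopf_curvature_flat _ _ _ s z N d U2 f X0 n2 H2 xi2 e0 u X.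
have /nbhs_ballP[r /= r0 rU] := open_near oU2 U20.
apply/nbhs_ballP; exists r => // u uB.
apply: (@derive0_ball_cst _ _ f u0 r) => //.
- by move=> w /rU Uw; exact: smooth_differentiable sf Uw.
- by move=> w X /rU; exact: df.
Qed.

End InCoordinates.
End HopfHypersurface.

Section Global.
Context {R : realType} {n : nat} (s : space_form) {S : topologicalType}.

Lemma Hopf_curvature_near (n2 : (2 <= n)%N) (h : hypersurface R n s S)
    (a : S -> R) (a_def : forall x, xi_curvature h x (a x)) x :
  \forall x' \near x, a x' = a x.
Proof.
have [k hk [xd xU]] := hs_smooth h x.
have [[Ak _] _ _ _ _] := hk; have [cA _ _] := hs_atlas h.
have [od _ K cm _] := cA _ Ak.
have near_u := Hopf_curvature_locally_constant n2 a_def hk xU.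
rewrite K // in near_u.
have cmx : cmap (src k) @ x --> cmap (src k) x.
  by move: cm; rewrite continuous_open_subspace // => /(_ x); apply; rewrite inE.
have h1 : \forall x' \near x, cdom (src k) x' by apply: open_nbhs_nbhs; split.
have h2 : \forall x' \near x,
    a (cinv (src k) (cmap (src k) x')) = a x by exact: cmx near_u.
by apply: filterS2 h1 h2 => x' x'd; rewrite K.
Qed.

Lemma locally_constant_connected (T : Type) (f : S -> T) :
  connected [set: S] -> (forall x, \forall x' \near x, f x' = f x) ->
  forall x y, f x = f y.
Proof.
move=> cS floc x y.
have oB (Q : set T) : open (f @^-1` Q).
  rewrite openE => w Qw; rewrite /interior.
  by apply: filterS (floc w) => w' /= ->.
suff : [set w | f x = f w] = [set: S] by move=> /seteqP[_ /(_ y I)].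
apply: cS; first by exists x.
- exists [set w | f x = f w]; last by rewrite setTI.
  exact: (oB [set t | f x = t]).
- exists [set w | f x = f w]; last by rewrite setTI.
  rewrite -[X in closed X]setCK; apply: open_closedC.
  exact: (oB (~` [set t | f x = t])).
Qed.
End Global.

Theorem theorem2 (R : realType) (n : nat) (s : space_form)
  (n_ge2 : (2 <= n)%N)
  (s_admissible : admissible R n s)
  (S : topologicalType) (h : hypersurface R n s S)
  (S_connected : connected [set: S])
  (h_Hopf : Hopf h)
  (a : S -> R) (a_def : forall x, xi_curvature h x (a x)) :
  exists a0 : R, forall x, a x = a0.
Proof.
have const := locally_constant_connected S_connected
  (Hopf_curvature_near n_ge2 a_def).
have [[x0 _]|S0] := pselect (exists x : S, True).
  by exists (a x0) => x; exact: const.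
by exists 0 => x; exfalso; apply: S0; exists x.
Qed.
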